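(* Let $w=y_1\ldots y_k$ and $v=x_1\ldots x_n$ be non-empty words over $\{0,1\}$ with $y_k\ne x_n$ and $(k,n)\ne(1,1)$. The group $\mathfrak{K}(w,v)$ has the presentation \[\mathfrak{K}(w,v)=\Big\langle a_1,\ldots,a_n,b_1,\dots,b_k\,\Big|\,\{\text{relations of }\overline F\}\cup\varphi^\ell(\mathcal R)\text{ for all }\ell\ge0\Big\rangle;\] that is, the natural map $\overline F\to\mathfrak{K}(w,v)$ sending each generator to the automorphism of the same name is well defined and surjective, and its kernel is the normal closure in $\overline F$ of $\bigcup_{\ell\ge0}\varphi^\ell(\mathcal R)$. Here $\overline F$, $\varphi$ and $\mathcal R$ are as defined in the context.
   Context: $[a,b]=a^{-1}b^{-1}ab$ and $a^b=b^{-1}ab$. Automorphisms of the binary rooted tree $\{0,1\}^*$ act on the right. $\langle\langle g_0,g_1\rangle\rangle$ denotes the automorphism $0u\mapsto0u^{g_0}$, $1u\mapsto1u^{g_1}$; $\sigma$ exchanges $0$ and $1$ in the first letter; $\langle\langle g_0,g_1\rangle\rangle\sigma$ means first apply $\langle\langle g_0,g_1\rangle\rangle$, then $\sigma$. **The group $\mathfrak{K}(w,v)$** is the subgroup of $\mathrm{Aut}(\{0,1\}^* )$ generated by $b_1,\dots,b_k,a_1,\dots,a_n$, where $b_1=\sigma$; for $1\le j<k$, $b_{j+1}=\langle\langle b_j,1\rangle\rangle$ if $y_j=0$ and $\langle\langle1,b_j\rangle\rangle$ if $y_j=1$; $a_1=\langle\langle b_k,a_n\rangle\rangle$ if $y_k=0,x_n=1$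 and $a_1=\langle\langle a_n,b_k\rangle\rangle$ if $y_k=1,x_n=0$; for $1\le i<n$, $a_{i+1}=\langle\langle a_i,1\rangle\rangle$ if $x_i=0$ and $\langle\langle1,a_i\rangle\rangle$ if $x_i=1$. **The group $F$ and the recursion $\Psi$.** Let $d$ be maximal such that $v=u^d$ for some word $u$. With indices of the $a_i$ taken modulo $n$, let $F=\langle a_1,\ldots,a_n,b_1,\ldots,b_k\mid a_i^2,\ b_j^2,\ [a_i,a_{i+\ell(n/d)}]\ (1\le i\le n,\ 1\le j\le k,\ 1\le\ell<d)\rangle$. Let $\Psi:F\to F\wr\mathfrak S_2=(F\times F)\rtimes\langle\sigma\rangle$ be the homomorphism given on generators by the same formulas as the recursive definition of the automorphisms above. **The elements $s,t\in F$ and the number $m$.** Fix choices as follows (statements ''in $\mathfrak K(w,v)$'' refer to images under the natural map $F\to\mathfrak K(w,v)$). - If $k,n\ge2$: $s\in\langle b_1\rangle$ is such that $[a_n^s,b_k]=1$ in $\mathfrak{K}(w,v)$; $t\in\langle b_1,b_2\rangle$ is such that $\Psi(a_1^t)=\langle\langle b_k,a_n^s\rangle\rangle$; $m=1$. - If $k\ge3$, $n=1$: $s\in\langle b_1,b_2\rangle$ is such that $[a_1^s,b_k]=1$ in $\mathfrak{K}(w,v)$; $t\in\langle b_1,b_2,b_3\rangle$ is such that $\Psi(a_1^t)=\langle\langle b_k,a_1^s\rangle\rangle$; $m=1$. - If $k=2$, $n=1$: $r,s\in\langle b_1\rangle$ are such that $b_2^r=\langle\langle b_1,1\rangle\rangle$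 and $a_1^{rs}=\langle\langle b_2,a_1\rangle\rangle$ in $\mathfrak{K}(w,v)$; $t\in\langle b_1,b_2\rangle$ is such that $\Psi(a_1^t)=\langle\langle b_2,a_1^s\rangle\rangle$; $m=2$. - If $k=1$, $n\ge2$: $s=1$; $t\in\langle b_1\rangle$ is such that $\Psi(a_1^t)=\langle\langle b_1,a_n\rangle\rangle$; $m=2$. Such choices exist in every case. **The endomorphism $\varphi$ of $F$:** for $1\le j<k$, $\varphi(b_j)=b_{j+1}$ if $y_j=0$ and $b_{j+1}^{b_1}$ if $y_j=1$; $\varphi(b_k)=a_1^t$; for $1\le i<n$, $\varphi(a_i)=a_{i+1}$ if $x_i=0$ and $a_{i+1}^{b_1}$ if $x_i=1$; $\varphi(a_n)=a_1$ if $x_n=0$ and $a_1^{b_1}$ if $x_n=1$. **The group $\overline F$** is the quotient of $F$ by the normal closure of $\{\varphi^\ell\big((a_n^sb_k)^{2^m}\big):\ell\ge0\}$; $\varphi$ induces an endomorphism of $\overline F$, also denoted $\varphi$. **The set $\mathcal R$.** Let $O$ (respectively $E$) be the set of elements of $\langle a_1^t,b_1\rangle<\overline F$ that, written as words in the two letters $a_1^t$ and $b_1$, contain an odd (respectively even) number of letters $b_1$. Then $\mathcal R\subset\overline F$ is the union of: - $\{[b_i,b_j^g]:2\le i,j\le k\}$, with $g\in O$ if $y_{i-1}=y_{j-1}$ and $g\in E$ if $y_{i-1}\ne y_{j-1}$; - $\{[a_i,b_j^g]:2\le i\le n,\ 2\le j\le k\}$, with $g\in O$ if $x_{i-1}=y_{j-1}$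 and $g\in E$ if $x_{i-1}\ne y_{j-1}$; - $\{[a_i,a_j^g]:2\le i,j\le n\}$, with $g\in O$ if $x_{i-1}=x_{j-1}$ and $g\in E$ if $x_{i-1}\ne x_{j-1}$. *)

(* Defs.v *)
From HB Require Import structures.
From mathcomp Require Import all_boot.
From mathcomp Require Import boolp classical_sets.

Set Implicit Arguments.
Unset Strict Implicit.
Unset Printing Implicit Defensive.

Local Open Scope classical_set_scope.
Local Open Scope group_scope.

Section Subgroups.
Variable G : groupType.
Implicit Types (S H : set G) (x y : G).

Definition is_subgroup H := H 1 /\ forall x y, H x -> H y -> H (x / y).

Definition is_normal_subgroup H :=
  is_subgroup H /\ forall x y, H x -> H (x ^ y).

Definition gen_subgroup S : set G := smallest is_subgroup S.

Definition normal_closure S : set G := smallest is_normal_subgroup S.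

Lemma normal_closure_normal S : is_normal_subgroup (normal_closure S).
Proof.
split; [split|] => [H [[[]]] // | x y Hx Hy H HH | x y Hx H HH].
  by have [[[_ HB] _] _] := HH; exact: HB (Hx H HH) (Hy H HH).
by have [[_ HJ] _] := HH; exact: HJ (Hx H HH).
Qed.

Lemma normal_closure1 S : normal_closure S 1.
Proof. by case: (normal_closure_normal S) => -[]. Qed.

Lemma normal_closureV S x : normal_closure S x -> normal_closure S x^-1.
Proof.
case: (normal_closure_normal S) => -[H1 HB] _ Hx.
by rewrite -div1g; apply: HB.
Qed.

Lemma normal_closureM S x y :
  normal_closure S x -> normal_closure S y -> normal_closure S (x * y).
Proof.
case: (normal_closure_normal S) => -[H1 HB] _ Hx Hy.
by rewrite -[y]invgK; apply: HB => //; apply: normal_closureV.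
Qed.

Lemma normal_closureJ S x y : normal_closure S x -> normal_closure S (x ^ y).
Proof. by case: (normal_closure_normal S) => _; apply. Qed.

End Subgroups.

(* The free group on X: reduced words in the letters (x, false) = x and       *)
(* (x, true) = x^-1.                                                          *)
Section FreeGroup.
Variable X : choiceType.
Implicit Types (a b : X * bool) (s u v : seq (X * bool)).

Definition letter_inv a : X * bool := (a.1, ~~ a.2).

Definition reduced s := sorted (fun a b => b != letter_inv a) s.

Record free_group :=
  FreeGroup { free_word :> seq (X * bool); free_wordP : reduced free_word }.

HB.instance Definition _ := [isSub for free_word].
HB.instance Definition _ := [Choice of free_group by <:].

Definition push a s :=
  if s is b :: s' then if b == letter_inv a then s' else a :: s else [:: a].

Lemma letter_invK : involutive letter_inv.
Proof. by case=> x e; rewrite /letter_inv /= negbK. Qed.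

Lemma reduced_push a s : reduced s -> reduced (push a s).
Proof.
case: s => [|b s] //= rs; case: ifP => [_|/negbT ab] /=; last by rewrite ab.
exact: path_sorted rs.
Qed.

Lemma reduced_foldr u s : reduced s -> reduced (foldr push s u).
Proof. by move=> rs; elim: u => //= a u; apply: reduced_push. Qed.

Lemma pushK a s : reduced s -> push (letter_inv a) (push a s) = s.
Proof.
case: s => [|b s] /=; first by rewrite letter_invK eqxx.
case: (b =P letter_inv a) => [->|_] /=; last by rewrite letter_invK eqxx.
case: s => [|c s] //= /andP[/negbTE cb _].
by rewrite cb.
Qed.

Lemma pushVK a s : reduced s -> push a (push (letter_inv a) s) = s.
Proof. by move=> rs; rewrite -[a in push a]letter_invK pushK. Qed.

Lemma foldr_pushA w v u : reduced v -> reduced w ->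
  foldr push w (foldr push v u) = foldr push (foldr push w v) u.
Proof.
move=> rv rw; elim: u => //= a u <-.
have := reduced_foldr u rv; move: (foldr push v u) => s rs.
case: s rs => [|b s] //= rs; case: (b =P letter_inv a) => //= ->.
by rewrite pushVK //; apply: reduced_foldr.
Qed.

Definition free_one := @FreeGroup [::] isT.
Definition free_mul (u v : free_group) :=
  FreeGroup (reduced_foldr u (free_wordP v)).

Lemma foldr_push_reduced u : reduced u -> foldr push [::] u = u.
Proof.
elim: u => //= a u IH ru; rewrite IH; last exact: path_sorted ru.
by case: u ru {IH} => //= b u /andP[/negbTE ->].
Qed.

Definition winv u := rev (map letter_inv u).

Lemma reduced_winv u : reduced u -> reduced (winv u).
Proof.
rewrite /reduced /winv rev_sorted sorted_map.
apply: sub_sorted => a b /=; apply: contraNneq => /(can_inj letter_invK) ->.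
by rewrite letter_invK.
Qed.

Definition free_inv (u : free_group) := FreeGroup (reduced_winv (free_wordP u)).

Lemma foldr_winvK u s : reduced s -> foldr push (foldr push s u) (winv u) = s.
Proof.
move=> rs; elim: u => //= a u IH.
by rewrite /winv /= rev_cons foldr_rcons pushK ?IH //; apply: reduced_foldr.
Qed.

Lemma winvK : involutive winv.
Proof. by move=> u; rewrite /winv map_rev revK mapK //; apply: letter_invK. Qed.

Fact free_mulA : associative free_mul.
Proof.
move=> u v w; apply: val_inj => /=.
by rewrite foldr_pushA ?free_wordP.
Qed.

Fact free_mul1 : left_id free_one free_mul.
Proof. by move=> u; apply: val_inj. Qed.

Fact free_mulr1 : right_id free_one free_mul.
Proof. by move=> u; apply: val_inj; rewrite /= foldr_push_reduced ?free_wordP. Qed.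

Fact free_mulV : left_inverse free_one free_inv free_mul.
Proof.
move=> u; apply: val_inj => /=.
by rewrite -[X in foldr _ X _](foldr_push_reduced (free_wordP u)) foldr_winvK.
Qed.

Fact free_mulVr : right_inverse free_one free_inv free_mul.
Proof.
move=> u; apply: val_inj => /=.
have := @foldr_winvK (winv u) [::] isT.
by rewrite winvK foldr_push_reduced ?reduced_winv ?free_wordP.
Qed.

HB.instance Definition _ := isGroup.Build free_group
  free_mulA free_mul1 free_mulr1 free_mulV free_mulVr.

Definition free_gen (x : X) : free_group := @FreeGroup [:: (x, false)] isT.

Section Lift.
Variables (G : groupType) (f : X -> G).

Definition letter_val a : G := if a.2 then (f a.1)^-1 else f a.1.

Definition free_lift (u : free_group) : G :=
  \prod_(a <- free_word u) letter_val a.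

Lemma free_lift_gen x : free_lift (free_gen x) = f x.
Proof. by rewrite /free_lift big_seq1. Qed.

Lemma free_liftM : {morph free_lift : u v / u * v}.
Proof.
move=> u v; rewrite /free_lift /=; elim: (free_word u) => [|a s IH] /=.
  by rewrite big_nil mul1g.
rewrite big_cons -mulgA -IH; case: (foldr _ _ _) => [|b t] /=.
  by rewrite big_seq1 big_nil mulg1.
case: eqP => [->|_]; rewrite !big_cons //.
by case: a => x [] /=; rewrite /letter_val /= ?mulKg ?mulVKg.
Qed.

End Lift.
End FreeGroup.

(* The quotient of G by the normal closure of S. *)
Section QuotientGroup.
Local Open Scope quotient_scope.
Variables (G : groupType) (S : set G).

Definition quot_rel (x y : G) : bool := `[< normal_closure S (x / y) >].

Fact quot_rel_refl : reflexive quot_rel.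
Proof. by move=> x; apply/asboolP; rewrite mulgV; apply: normal_closure1. Qed.

Fact quot_rel_sym : symmetric quot_rel.
Proof.
have H x y : quot_rel x y -> quot_rel y x.
  by move=> /asboolP h; apply/asboolP; rewrite -invgF; apply: normal_closureV.
by move=> x y; apply/idP/idP; apply: H.
Qed.

Fact quot_rel_trans : transitive quot_rel.
Proof.
move=> y x z /asboolP xy /asboolP yz; apply/asboolP.
by rewrite -(divgKA y); apply: normal_closureM => //; rewrite mulgA.
Qed.

Canonical quot_equiv := EquivRel quot_rel quot_rel_refl quot_rel_sym quot_rel_trans.

Definition quot_group := {eq_quot quot_equiv}.

HB.instance Definition _ := Choice.on quot_group.

Definition quot_proj (x : G) : quot_group := \pi_{eq_quot quot_equiv} x.
Definition quot_repr (c : quot_group) : G := repr (c : {eq_quot quot_equiv}).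

Lemma quot_reprK : cancel quot_repr quot_proj.
Proof. by move=> c; apply: reprK. Qed.

Lemma quot_projP x y : quot_proj x = quot_proj y <-> normal_closure S (x / y).
Proof.
split; first by move=> /eqmodP /asboolP.
by move=> h; apply/eqmodP/asboolP.
Qed.

Definition quot_mul (c d : quot_group) := quot_proj (quot_repr c * quot_repr d).
Definition quot_inv (c : quot_group) := quot_proj (quot_repr c)^-1.

Lemma quot_mulE x y : quot_mul (quot_proj x) (quot_proj y) = quot_proj (x * y).
Proof.
have /quot_projP hx : quot_proj (quot_repr (quot_proj x)) = quot_proj x.
  exact: quot_reprK.
have /quot_projP hy : quot_proj (quot_repr (quot_proj y)) = quot_proj y.
  exact: quot_reprK.
apply/quot_projP; move: (quot_repr (_ x)) (quot_repr (_ y)) hx hy => x' y' hx hy.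
have -> : x' * y' / (x * y) = (y' / y) ^ x'^-1 * (x' / x).
  by rewrite conjgE invgK invgM !mulgA mulgVK.
by apply: normal_closureM => //; apply: normal_closureJ.
Qed.

Lemma quot_invE x : quot_inv (quot_proj x) = quot_proj x^-1.
Proof.
have /quot_projP hx : quot_proj (quot_repr (quot_proj x)) = quot_proj x.
  exact: quot_reprK.
apply/quot_projP; move: (quot_repr _) hx => x' hx.
have -> : x'^-1 / x^-1 = ((x' / x)^-1) ^ x'.
  by rewrite conjgE invgF invgK !mulgA mulgVK.
by apply: normal_closureJ; apply: normal_closureV.
Qed.

Fact quot_mulA : associative quot_mul.
Proof.
move=> a b c; rewrite -[a]quot_reprK -[b]quot_reprK -[c]quot_reprK.
by rewrite !quot_mulE mulgA.
Qed.
Fact quot_mul1 : left_id (quot_proj 1) quot_mul.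
Proof. by move=> a; rewrite -[a]quot_reprK quot_mulE mul1g. Qed.
Fact quot_mulr1 : right_id (quot_proj 1) quot_mul.
Proof. by move=> a; rewrite -[a]quot_reprK quot_mulE mulg1. Qed.
Fact quot_mulV : left_inverse (quot_proj 1) quot_inv quot_mul.
Proof. by move=> a; rewrite -[a]quot_reprK quot_invE quot_mulE mulVg. Qed.
Fact quot_mulVr : right_inverse (quot_proj 1) quot_inv quot_mul.
Proof. by move=> a; rewrite -[a]quot_reprK quot_invE quot_mulE mulgV. Qed.

HB.instance Definition _ := isGroup.Build quot_group
  quot_mulA quot_mul1 quot_mulr1 quot_mulV quot_mulVr.

Lemma quot_projM : {morph quot_proj : x y / x * y}.
Proof. by move=> x y; rewrite [RHS]quot_mulE. Qed.

Lemma quot_proj_eq1 x : quot_proj x = 1 <-> normal_closure S x.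
Proof. by rewrite -[x in X in _ <-> X]divg1; apply: quot_projP. Qed.

End QuotientGroup.

(* The map induced on G / <<S>>^G by f : G -> H, meaningful when f kills S.   *)
Section QuotientLift.
Variables (G H : groupType) (S : set G) (f : G -> H).

Definition quot_lift (c : quot_group S) : H := f (quot_repr c).

Hypothesis fM : {morph f : x y / x * y}.
Hypothesis fS : forall x, S x -> f x = 1.

Lemma morph_one : f 1 = 1.
Proof. by apply: (@mulgI _ (f 1)); rewrite -fM !mulg1. Qed.

Lemma morphV x : f x^-1 = (f x)^-1.
Proof. by apply: (@mulgI _ (f x)); rewrite -fM !mulgV morph_one. Qed.

Lemma morph_conj x y : f (x ^ y) = f x ^ f y.
Proof. by rewrite !conjgE !fM morphV. Qed.

Lemma morph_comm x y : f [~ x, y] = [~ f x, f y].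
Proof. by rewrite /commg fM morphV morph_conj. Qed.

Lemma morph_exp x n : f (x ^+ n) = f x ^+ n.
Proof.
by elim: n => [|n IH]; [exact: morph_one | rewrite !expgS fM IH].
Qed.

Lemma normal_closure_kernel x : normal_closure S x -> f x = 1.
Proof.
move=> /(_ [set y | f y = 1]); apply; split => //; split; first split.
- exact: morph_one.
- by move=> y z fy fz; rewrite /mkset fM morphV fy fz mulgV.
- by move=> y z fy; rewrite /mkset morph_conj fy conj1g.
Qed.

Lemma quot_lift_proj x : quot_lift (quot_proj S x) = f x.
Proof.
have /quot_projP/normal_closure_kernel := quot_reprK (quot_proj S x).
by rewrite fM morphV => /divg1_eq.
Qed.

Lemma quot_liftM : {morph quot_lift : c d / c * d}.
Proof.
move=> c d; rewrite -[c]quot_reprK -[d]quot_reprK -quot_projM.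
by rewrite !quot_lift_proj.
Qed.

End QuotientLift.

Section Presentation.
Variables (X : choiceType) (rels : set (free_group X)).

Definition presented := quot_group rels.
HB.instance Definition _ := Group.on presented.

Definition pres_gen (x : X) : presented := quot_proj rels (free_gen x).

Definition pres_lift (G : groupType) (f : X -> G) : presented -> G :=
  quot_lift (free_lift f).

Section PresLiftTheory.
Variables (G : groupType) (f : X -> G).
Hypothesis f_rels : forall r, rels r -> free_lift f r = 1.

Lemma pres_liftM : {morph pres_lift f : x y / x * y}.
Proof. by apply: quot_liftM => //; apply: free_liftM. Qed.

Lemma pres_lift_gen x : pres_lift f (pres_gen x) = f x.
Proof.
by rewrite /pres_lift quot_lift_proj ?free_lift_gen //; apply: free_liftM.
Qed.

End PresLiftTheory.
End Presentation.

(* G wr S_2 = (G x G) ><| <sigma>; (g0, g1, e) stands for <<g0, g1>> sigma^e. *)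
Section Wreath.
Variable G : groupType.

Definition wreath : Type := (G * G * bool)%type.
HB.instance Definition _ := Choice.on wreath.

Implicit Types p q r : wreath.

Definition wpair (g0 g1 : G) : wreath := (g0, g1, false).

Definition wreath_one : wreath := (1, 1, false).
Definition wreath_mul p q : wreath :=
  let: (p0, p1, e) := p in let: (q0, q1, f) := q in
  if e then (p0 * q1, p1 * q0, ~~ f) else (p0 * q0, p1 * q1, f).
Definition wreath_inv p : wreath :=
  let: (p0, p1, e) := p in
  if e then (p1^-1, p0^-1, true) else (p0^-1, p1^-1, false).

Fact wreath_mulA : associative wreath_mul.
Proof. by move=> [[? ?] []] [[? ?] []] [[? ?] []] /=; rewrite !mulgA. Qed.
Fact wreath_mul1 : left_id wreath_one wreath_mul.
Proof. by move=> [[? ?] ?] /=; rewrite !mul1g. Qed.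
Fact wreath_mulr1 : right_id wreath_one wreath_mul.
Proof. by move=> [[? ?] []] /=; rewrite !mulg1. Qed.
Fact wreath_mulV : left_inverse wreath_one wreath_inv wreath_mul.
Proof. by move=> [[? ?] []] /=; rewrite !mulVg. Qed.
Fact wreath_mulVr : right_inverse wreath_one wreath_inv wreath_mul.
Proof. by move=> [[? ?] []] /=; rewrite !mulgV. Qed.

HB.instance Definition _ := isGroup.Build wreath
  wreath_mulA wreath_mul1 wreath_mulr1 wreath_mulV wreath_mulVr.

End Wreath.

(* Vertices of the binary tree are words, the root being the empty word;      *)
(* its automorphisms are the bijections preserving the prefix order.          *)
Record tree_aut := TreeAut {
  tree_act :> seq bool -> seq bool;
  tree_act_inv : seq bool -> seq bool;
  tree_actK : cancel tree_act tree_act_inv;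
  tree_actVK : cancel tree_act_inv tree_act;
  tree_act_prefix : {mono tree_act : u v / prefix u v} }.

HB.instance Definition _ := gen_eqMixin tree_aut.
HB.instance Definition _ := gen_choiceMixin tree_aut.

Lemma tree_autP (g h : tree_aut) : g =1 h <-> g = h.
Proof.
split=> [|-> //]; case: g h => [g g' gK gVK gp] [h h' hK hVK hp] /= /funext gh.
rewrite -{}gh in hK hVK hp *.
have g'h' : g' = h' by apply/funext => u; rewrite -[u in LHS]hVK gK.
rewrite -{}g'h' in hK hVK *.
by congr TreeAut; apply: Prop_irrelevance.
Qed.

(* Right action: u ^ (g * h) = (u ^ g) ^ h. *)
Section TreeAutGroup.
Implicit Types g h : tree_aut.

Definition tree_one : tree_aut :=
  @TreeAut id id (fun=> erefl) (fun=> erefl) (fun _ _ => erefl).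

Fact tree_mul_prefix g h : {mono (h \o g) : u v / prefix u v}.
Proof. by move=> u v /=; rewrite !tree_act_prefix. Qed.
Definition tree_mul g h : tree_aut :=
  TreeAut (can_comp (@tree_actK h) (@tree_actK g))
          (can_comp (@tree_actVK g) (@tree_actVK h)) (tree_mul_prefix g h).

Fact tree_inv_prefix g : {mono (tree_act_inv g) : u v / prefix u v}.
Proof. by move=> u v; rewrite -(tree_act_prefix g) !tree_actVK. Qed.
Definition tree_inv g : tree_aut :=
  TreeAut (@tree_actVK g) (@tree_actK g) (@tree_inv_prefix g).

Fact tree_mulA : associative tree_mul.
Proof. by move=> g h k; apply/tree_autP. Qed.
Fact tree_mul1 : left_id tree_one tree_mul.
Proof. by move=> g; apply/tree_autP. Qed.
Fact tree_mulr1 : right_id tree_one tree_mul.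
Proof. by move=> g; apply/tree_autP. Qed.
Fact tree_mulV : left_inverse tree_one tree_inv tree_mul.
Proof. by move=> g; apply/tree_autP => u /=; rewrite tree_actVK. Qed.
Fact tree_mulVr : right_inverse tree_one tree_inv tree_mul.
Proof. by move=> g; apply/tree_autP => u /=; rewrite tree_actK. Qed.

HB.instance Definition _ := isGroup.Build tree_aut
  tree_mulA tree_mul1 tree_mulr1 tree_mulV tree_mulVr.

End TreeAutGroup.

(* tree_wr p is the automorphism <<g0, g1>> sigma^e, for p = (g0, g1, e).      *)
Section TreeWreath.
Variable p : wreath tree_aut.

Definition tree_wr_act (u : seq bool) : seq bool :=
  let: (g0, g1, e) := p in
  if u is c :: u' then (c (+) e) :: (if c then g1 else g0) u' else [::].

Definition tree_wr_inv (u : seq bool) : seq bool :=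
  let: (g0, g1, e) := p in
  if u is c :: u' then
    (c (+) e) :: tree_act_inv (if c (+) e then g1 else g0) u'
  else [::].

Fact tree_wr_actK : cancel tree_wr_act tree_wr_inv.
Proof.
rewrite /tree_wr_act /tree_wr_inv; case: p => [[g0 g1] e] [|c u] //.
by rewrite addbK tree_actK.
Qed.

Fact tree_wr_actVK : cancel tree_wr_inv tree_wr_act.
Proof.
rewrite /tree_wr_act /tree_wr_inv; case: p => [[g0 g1] e] [|c u] //.
by rewrite addbK tree_actVK.
Qed.

Fact tree_wr_prefix : {mono tree_wr_act : u v / prefix u v}.
Proof.
rewrite /tree_wr_act; case: p => [[g0 g1] e] [|c u] [|d v] //.
rewrite !prefix_cons (inj_eq (@addIb e)).
by case: eqP => //= ->; rewrite tree_act_prefix.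
Qed.

Definition tree_wr : tree_aut := TreeAut tree_wr_actK tree_wr_actVK tree_wr_prefix.

End TreeWreath.

Definition tree_pair (g0 g1 : tree_aut) : tree_aut := tree_wr (wpair g0 g1).

(* letter u i is the i-th letter of u, numbered from 1.                       *)
Definition letter (u : seq bool) (i : nat) : bool := nth false u i.-1.

(* The maximal d such that v = u^d for some u; for non-empty v one has        *)
(* d <= size v, so that the bound below is harmless.                          *)
Definition root_exponent (v : seq bool) : nat :=
  \max_(d < (size v).+1 | `[< exists u, v = flatten (nseq d u) >]) d.

Section KneadingGroup.
Variables w v : seq bool.
Local Notation k := (size w).
Local Notation n := (size v).
Local Notation y_ := (letter w).
Local Notation x_ := (letter v).
Local Notation d := (root_exponent v).

(* inl j stands for b_(j+1), inr i for a_(i+1). The index types have k and n  *)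
(* elements when w and v are non-empty.                                       *)
Definition gen : Type := ('I_k.-1.+1 + 'I_n.-1.+1)%type.
HB.instance Definition _ := Choice.on gen.

(* genB j (1 <= j <= k) and genA i (i >= 1, taken modulo n) are the           *)
(* generators b_j and a_i with the usual numbering.                           *)
Definition genB (j : nat) : gen := inl (inord j.-1).
Definition genA (i : nat) : gen := inr (inord (i.-1 %% n)).

(* The wreath recursion; None stands for the identity. As y_k <> x_n, the     *)
(* value of y_k determines which formula for a_1 applies.                     *)
Definition wrec (g : gen) : option gen * option gen * bool :=
  match g with
  | inl j =>
    if val j == 0 then (None, None, true)
    else if y_ j then (None, Some (genB j), false)
    else (Some (genB j), None, false)
  | inr i =>
    if val i == 0 then
      if y_ k then (Some (genA n), Some (genB k), false)
      else (Some (genB k), Some (genA n), false)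
    else if x_ i then (None, Some (genA i), false)
    else (Some (genA i), None, false)
  end.

Definition wrec_val (G : groupType) (f : gen -> G) (g : gen) : wreath G :=
  let: (g0, g1, e) := wrec g in (oapp f 1 g0, oapp f 1 g1, e).

Fixpoint gen_act (g : gen) (u : seq bool) : seq bool :=
  if u is c :: u' then
    let: (g0, g1, e) := wrec g in
    (c (+) e) :: (if (if c then g1 else g0) is Some h then gen_act h u' else u')
  else [::].

Lemma gen_actK g : cancel (gen_act g) (gen_act g).
Proof.
move=> u; elim: u g => [|c u IH] //= g.
have: (wrec g).2 = false \/ wrec g = (None, None, true).
  by case: g => [j|i] /=; do !case: ifP => _; auto.
case E: (wrec g) => [[g0 g1] e] /=; rewrite E => -[/= ->|[-> -> ->]].
  by rewrite !addbF; case: c; [case: (g1) | case: (g0)] => //= h; rewrite IH.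
by case: c.
Qed.

Lemma gen_act_prefix g : {mono (gen_act g) : u u' / prefix u u'}.
Proof.
move=> u u'; elim: u g u' => [|c u IH] g [|c' u'] //=;
  case: (wrec g) => -[g0 g1] e //=.
have -> : (c (+) e == c' (+) e) = (c == c') by case: c c' e => [] [] [].
by case: eqP => //= <-; case: (if c then g1 else g0) => // h; rewrite IH.
Qed.

Definition gen_aut (g : gen) : tree_aut :=
  TreeAut (gen_actK g) (gen_actK g) (gen_act_prefix g).

Lemma gen_autE g : gen_aut g = tree_wr (wrec_val gen_aut g).
Proof.
apply/tree_autP => -[|c u] /=; rewrite /tree_wr_act /wrec_val;
  case: (wrec g) => -[g0 g1] e //=.
by case: c; [case: g1 | case: g0].
Qed.

Definition K : set tree_aut := gen_subgroup (range gen_aut).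

Definition F_rels : set (free_group gen) :=
  [set r | (exists g, r = free_gen g ^+ 2) \/
    exists i l, [/\ (1 <= i <= n)%N, (1 <= l < d)%N &
      r = [~ free_gen (genA i), free_gen (genA (i + l * (n %/ d))%N)]]].

Definition F : Type := presented F_rels.
HB.instance Definition _ := Group.on F.

Definition F_gen (g : gen) : F := pres_gen F_rels g.
Local Notation b_ j := (F_gen (genB j)).
Local Notation a_ i := (F_gen (genA i)).

Definition natF : F -> tree_aut := pres_lift gen_aut.

Definition Psi : F -> wreath F := pres_lift (wrec_val F_gen).

Inductive good_choice : F -> F -> nat -> Prop :=
| GoodChoiceKN s t of
    2 <= k & 2 <= n &
    gen_subgroup [set b_ 1] s & natF [~ a_ n ^ s, b_ k] = 1 &
    gen_subgroup [set b_ 1; b_ 2] t & Psi (a_ 1 ^ t) = wpair (b_ k) (a_ n ^ s) :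
  good_choice s t 1
| GoodChoiceK1 s t of
    3 <= k & n = 1%N &
    gen_subgroup [set b_ 1; b_ 2] s & natF [~ a_ 1 ^ s, b_ k] = 1 &
    gen_subgroup [set b_ 1; b_ 2; b_ 3] t &
    Psi (a_ 1 ^ t) = wpair (b_ k) (a_ 1 ^ s) :
  good_choice s t 1
| GoodChoice21 r s t of
    k = 2%N & n = 1%N &
    gen_subgroup [set b_ 1] r & gen_subgroup [set b_ 1] s &
    natF (b_ 2 ^ r) = tree_pair (gen_aut (genB 1)) 1 &
    natF (a_ 1 ^ (r * s)) = tree_pair (gen_aut (genB 2)) (gen_aut (genA 1)) &
    gen_subgroup [set b_ 1; b_ 2] t & Psi (a_ 1 ^ t) = wpair (b_ 2) (a_ 1 ^ s) :
  good_choice s t 2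
| GoodChoice1N t of
    k = 1%N & 2 <= n &
    gen_subgroup [set b_ 1] t & Psi (a_ 1 ^ t) = wpair (b_ 1) (a_ n) :
  good_choice 1 t 2.

Section Phi.
Variables (s t : F) (m : nat).

Definition phi_gen (g : gen) : F :=
  match g with
  | inl j0 => let j := j0.+1 in
    if j < k then (if y_ j then b_ j.+1 ^ b_ 1 else b_ j.+1) else a_ 1 ^ t
  | inr i0 => let i := i0.+1 in
    if x_ i then a_ i.+1 ^ b_ 1 else a_ i.+1
  end.

Definition phi : F -> F := pres_lift phi_gen.

Definition Fbar_rels : set F :=
  range (fun l => iter l phi ((a_ n ^ s * b_ k) ^+ (2 ^ m)%N)).

Definition Fbar : Type := quot_group Fbar_rels.
HB.instance Definition _ := Group.on Fbar.

Definition Fbar_proj : F -> Fbar := @quot_proj F Fbar_rels.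
Definition Fbar_gen (g : gen) : Fbar := Fbar_proj (F_gen g).
Local Notation bb_ j := (Fbar_gen (genB j)).
Local Notation ab_ i := (Fbar_gen (genA i)).

Definition phibar : Fbar -> Fbar := @quot_lift F Fbar Fbar_rels (Fbar_proj \o phi).

(* words_parity true and words_parity false are the sets O and E; in a word,  *)
(* true stands for the letter b_1 and false for a_1^t.                        *)
Definition words_parity (p : bool) : set Fbar :=
  [set g | exists2 u : seq bool, odd (count id u) = p &
     g = \prod_(c <- u) (if c then bb_ 1 else Fbar_proj (a_ 1 ^ t))].

Definition R_bb : set Fbar :=
  [set r | exists i j g, [/\ 2 <= i <= k, 2 <= j <= k,
     words_parity (y_ i.-1 == y_ j.-1) g & r = [~ bb_ i, bb_ j ^ g]]].
Definition R_ab : set Fbar :=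
  [set r | exists i j g, [/\ 2 <= i <= n, 2 <= j <= k,
     words_parity (x_ i.-1 == y_ j.-1) g & r = [~ ab_ i, bb_ j ^ g]]].
Definition R_aa : set Fbar :=
  [set r | exists i j g, [/\ 2 <= i <= n, 2 <= j <= n,
     words_parity (x_ i.-1 == x_ j.-1) g & r = [~ ab_ i, ab_ j ^ g]]].

Definition calR : set Fbar := R_bb `|` R_ab `|` R_aa.

End Phi.

Section WellDefined.
Hypotheses (w_gt0 : 0 < k) (v_gt0 : 0 < n) (last_neq : y_ k != x_ n).

Local Notation q := (n %/ d).

Lemma root_exponentP : exists u, v = flatten (nseq d u).
Proof.
have h1 : `[< exists u, v = flatten (nseq (@Ordinal n.+1 1 v_gt0) u) >].
  by apply/asboolP; exists v; rewrite /= cats0.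
rewrite /root_exponent (bigmax_eq_arg _ h1).
by case: arg_maxnP => // i /asboolP.
Qed.

Lemma nth_flatten_nseq (u : seq bool) e i : i < size (flatten (nseq e u)) ->
  nth false (flatten (nseq e u)) i = nth false u (i %% size u).
Proof.
elim: e i => [|e IH] i //=; rewrite size_cat nth_cat => hi.
case: ltnP => ui; first by rewrite modn_small.
rewrite IH; last by rewrite ltn_subLR.
by rewrite -[in RHS](subnKC ui) modnDl.
Qed.

Lemma size_flatten_nseq (u : seq bool) e :
  size (flatten (nseq e u)) = (e * size u)%N.
Proof. by elim: e => //= e IH; rewrite size_cat IH mulSn. Qed.

Lemma root_exponent_dvd : (d * q)%N = n.
Proof.
have [u vu] := root_exponentP; rewrite mulnC divnK //.
by rewrite {2}vu size_flatten_nseq dvdn_mulr.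
Qed.

Definition xc i := nth false v (i.-1 %% n).

Lemma xc_period i l : 0 < i -> xc (i + l * q)%N = xc i.
Proof.
move=> i0; have [u vu] := root_exponentP.
have dq := root_exponent_dvd.
have d0 : 0 < d by move: v_gt0; rewrite -dq muln_gt0 => /andP[].
have uq : size u = q.
  have := size_flatten_nseq u d; rewrite -vu -{1}dq => /eqP.
  by rewrite eqn_pmul2l // => /eqP.
have X j : nth false v (j %% n) = nth false u (j %% q).
  rewrite {1}vu nth_flatten_nseq -?vu ?ltn_mod // uq.
  by rewrite -{1}dq modn_dvdm // dvdn_mull.
rewrite /xc !X; case: i i0 => // i _ /=.
by rewrite addnC modnMDl.
Qed.

Lemma genA_val i : 0 < i -> nat_of_ord (inord (i.-1 %% n) : 'I_n.-1.+1) = (i.-1 %% n)%N.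
Proof. by move=> _; rewrite inordK // prednK // ltn_mod. Qed.

Lemma genA_modn i j : i.-1 = j.-1 %[mod n] -> genA i = genA j.
Proof. by rewrite /genA => ->. Qed.

Lemma genA_shift i : 0 < i ->
  exists2 j, 0 < j & forall r, genA (i + r)%N = genA (j + r)%N.+1.
Proof.
case: i => // i _; exists (i + n)%N; first by rewrite addn_gt0 v_gt0 orbT.
by move=> r; apply: genA_modn; rewrite /= addnAC modnDr.
Qed.

Lemma wrecA i : 0 < i -> wrec (genA i.+1) =
  let o := if i %% n == 0 then Some (genB k) else None in
  if xc i then (o, Some (genA i), false) else (Some (genA i), o, false).
Proof.
move=> i0; rewrite /wrec [genA i.+1]/genA /= -[val _]/(nat_of_ord _).
rewrite -[X in inord (X %% n)]/(i.+1.-1) genA_val //=.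
case: eqP => [i1|/eqP i1].
  have Ei : i.-1 = n.-1 %[mod n].
    by case: i i0 i1 => // i _ /= /eqP; case: (n) v_gt0 => // N _;
      rewrite -[X in _ = X %[mod _]]/(N); move=> /eqP h; apply/eqP;
      rewrite -(eqn_modDr 1) !addn1 h modnn.
  rewrite (genA_modn Ei) /xc Ei modn_small ?prednK //.
  rewrite -/(x_ n); move: last_neq.
  by case: (y_ k) (x_ n) => [] [].
have Ei : i.-1 = (i %% n).-1 %[mod n].
  rewrite {1}(divn_eq i n); case: (i %% n) i1 => // r _.
  by rewrite addnS /= modnMDl.
rewrite (genA_modn Ei) /xc Ei (modn_small (m := (i %% n).-1)) //.
by apply: leq_ltn_trans (leq_pred _) _; rewrite ltn_mod.
Qed.

Lemma F_rels_lift (G : groupType) (f : gen -> G) :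
  (forall g, f g * f g = 1) ->
  (forall i l, 0 < i -> commute (f (genA i)) (f (genA (i + l * q)%N))) ->
  forall r, F_rels r -> free_lift f r = 1.
Proof.
move=> f2 fC r [[g ->]|[i [l [/andP[i0 _] _ ->]]]].
  by rewrite (morph_exp (free_liftM f)) free_lift_gen [f g ^+ 2]f2.
rewrite (morph_comm (free_liftM f)) !free_lift_gen.
exact/eqP/commgP/fC.
Qed.

Lemma F_gen2 g : F_gen g * F_gen g = 1.
Proof.
rewrite -[LHS]quot_projM; apply/quot_proj_eq1.
by apply: sub_gen_smallest; left; exists g.
Qed.

Lemma F_genC i l : 0 < i -> commute (a_ i) (a_ (i + l * q)%N).
Proof.
move=> i0; have dq := root_exponent_dvd.
have d0 : 0 < d by move: v_gt0; rewrite -dq muln_gt0 => /andP[].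
set i' := (i.-1 %% n).+1.
have -> : genA i = genA i' by apply: genA_modn; rewrite /i' /= modn_mod.
have -> : genA (i + l * q)%N = genA (i' + (l %% d) * q)%N.
  apply: genA_modn; case: i i0 @i' => // i _ /=.
  rewrite modnDml {1}(divn_eq l d) mulnDl -mulnA dq.
  by rewrite addnCA modnMDl.
case: (posnP (l %% d)) => [->|l0]; first by rewrite mul0n addn0.
apply/commgP/eqP; rewrite -(morph_comm (@quot_projM _ _)).
apply/quot_proj_eq1; apply: sub_gen_smallest; right; exists i', (l %% d)%N.
by split; rewrite // ?l0 ltn_mod.
Qed.

Section WrecVal.
Variables (G : groupType) (f : gen -> G).
Hypothesis f2 : forall g, f g * f g = 1.

Lemma wrec_val2 g : wrec_val f g * wrec_val f g = 1.
Proof.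
rewrite /wrec_val; case: g => [j|i] /=; do !case: ifP => _ /=;
  by congr (_, _, _); rewrite /= ?f2 ?mulg1.
Qed.

Hypothesis fC : forall i l, 0 < i -> commute (f (genA i)) (f (genA (i + l * q)%N)).

Lemma wrec_valC i l : 0 < i ->
  commute (wrec_val f (genA i)) (wrec_val f (genA (i + l * q)%N)).
Proof.
move=> /genA_shift[i' i'0 Ei].
rewrite -[X in genA X]addn0 !Ei addn0.
have i''0 : 0 < (i' + l * q)%N by rewrite addn_gt0 i'0.
rewrite /wrec_val !wrecA // xc_period //.
set o1 := if _ then _ else _; set o2 := if _ then _ else _.
have oC : oapp f 1 o1 * oapp f 1 o2 = oapp f 1 o2 * oapp f 1 o1.
  by rewrite /o1 /o2; do 2!case: ifP => _ //=; rewrite ?mulg1 ?mul1g.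
have aC := fC l i'0; rewrite /commute in aC *.
case: ifP => _ /=; rewrite -[LHS]/(wreath_mul _ _) -[RHS]/(wreath_mul _ _) /=.
  by rewrite oC aC.
by rewrite oC aC.
Qed.

End WrecVal.

Lemma PsiM : {morph Psi : x y / x * y}.
Proof.
apply: pres_liftM; apply: F_rels_lift => [g|i l].
  by apply: wrec_val2; apply: F_gen2.
by apply: wrec_valC; apply: F_genC.
Qed.

Lemma Psi_gen g : Psi (F_gen g) = wrec_val F_gen g.
Proof.
apply: pres_lift_gen; apply: F_rels_lift => [h|i l].
  by apply: wrec_val2; apply: F_gen2.
by apply: wrec_valC; apply: F_genC.
Qed.

Lemma gen_aut2 g : gen_aut g * gen_aut g = 1.
Proof. by apply/tree_autP => u /=; rewrite gen_actK. Qed.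

Lemma gen_actA i c u : 0 < i -> gen_act (genA i.+1) (c :: u) =
  c :: (if c == xc i then gen_act (genA i) u
        else if i %% n == 0 then gen_act (genB k) u else u).
Proof.
move=> i0; rewrite -[LHS]/(let: (g0, g1, e) := wrec (genA i.+1) in
  (c (+) e) :: (if (if c then g1 else g0) is Some h then gen_act h u else u)).
rewrite wrecA //.
by case: (xc i); case: c; case: (_ == 0).
Qed.

Lemma gen_autC i l : 0 < i ->
  commute (gen_aut (genA i)) (gen_aut (genA (i + l * q)%N)).
Proof.
suff H u j : 0 < j -> gen_act (genA (j + l * q)%N.+1) (gen_act (genA j.+1) u) =
    gen_act (genA j.+1) (gen_act (genA (j + l * q)%N.+1) u).
  move=> /genA_shift[j j0 Ej]; apply/tree_autP => u.
  by rewrite -[X in genA X]addn0 !Ej addn0 /= H.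
elim: u j => [|c u IH] j j0 //; rewrite !gen_actA ?addn_gt0 ?j0 // xc_period //.
have gC : gen_act (genA (j + l * q)%N) (gen_act (genA j) u) =
    gen_act (genA j) (gen_act (genA (j + l * q)%N) u).
  have [j' j'0 Ej] := genA_shift j0.
  by have := IH j' j'0; rewrite -Ej -{1 2}[j']addn0 -Ej addn0.
by congr cons; case: (c == xc j); last (do 2!case: ifP).
Qed.

Lemma natFM : {morph natF : x y / x * y}.
Proof.
by apply: pres_liftM; apply: F_rels_lift => [g|i l]; [apply: gen_aut2|apply: gen_autC].
Qed.

Lemma natF_gen g : natF (F_gen g) = gen_aut g.
Proof.
by apply: pres_lift_gen; apply: F_rels_lift => [h|i l]; [apply: gen_aut2|apply: gen_autC].
Qed.

Section PhiTheory.
Variables (s t : F) (m : nat).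

Lemma phi_genA i : 0 < i ->
  phi_gen t (genA i) = if xc i then a_ i.+1 ^ b_ 1 else a_ i.+1.
Proof.
move=> i0; rewrite /phi_gen [genA i]/genA genA_val //.
rewrite -/(xc i) /letter /= -/(xc i).
suff -> : genA (i.-1 %% n).+2 = genA i.+1 by [].
by apply: genA_modn => /=; case: i i0 => // i _; rewrite /= -addn1 modnDml addn1.
Qed.

Lemma phi_gen2 g : phi_gen t g * phi_gen t g = 1.
Proof.
have J (x y : F) : x * x = 1 -> x ^ y * x ^ y = 1 by move=> xx; rewrite -conjMg xx conj1g.
by case: g => [j|i] /=; do ?case: ifP => _; rewrite ?F_gen2 // J ?F_gen2.
Qed.

Lemma phi_genC i l : 0 < i ->
  commute (phi_gen t (genA i)) (phi_gen t (genA (i + l * q)%N)).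
Proof.
move=> i0; rewrite !phi_genA ?addn_gt0 ?i0 // xc_period // -addSn.
case: ifP => _; last exact: F_genC.
by rewrite /commute -!conjMg F_genC.
Qed.

Lemma phiM : {morph phi t : x y / x * y}.
Proof.
by apply: pres_liftM; apply: F_rels_lift => [g|i l]; [apply: phi_gen2|apply: phi_genC].
Qed.

Lemma phi_F_gen g : phi t (F_gen g) = phi_gen t g.
Proof.
by apply: pres_lift_gen; apply: F_rels_lift => [h|i l]; [apply: phi_gen2|apply: phi_genC].
Qed.

Let projM : {morph @Fbar_proj s t m : x y / x * y}.
Proof. exact: quot_projM. Qed.

Let phi_rels x : Fbar_rels s t m x -> (Fbar_proj s t m \o phi t) x = 1.
Proof.
move=> [l _ <-]; apply/quot_proj_eq1; apply: sub_gen_smallest.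
by exists l.+1.
Qed.

Let proj_phiM : {morph Fbar_proj s t m \o phi t : x y / x * y}.
Proof. by move=> x y /=; rewrite phiM projM. Qed.

Lemma phibarM : {morph @phibar s t m : x y / x * y}.
Proof. exact: (quot_liftM proj_phiM phi_rels). Qed.

Lemma phibar_proj x : @phibar s t m (Fbar_proj s t m x) = Fbar_proj s t m (phi t x).
Proof. exact: (quot_lift_proj proj_phiM phi_rels). Qed.

End PhiTheory.

Section ChoicesExist.
Hypothesis not11 : (k, n) != (1%N, 1%N).

Let wat (c : bool) (x : F) : wreath F := if c then wpair 1 x else wpair x 1.

Let genBE j : 0 < j -> j <= k -> nat_of_ord (inord j.-1 : 'I_k.-1.+1) = j.-1.
Proof. by move=> j0 jk; rewrite inordK // ltnS -!subn1 leq_sub2r. Qed.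

Let PsiJ x y : Psi (x ^ y) = Psi x ^ Psi y.
Proof. exact: morph_conj PsiM _ _. Qed.

Let Psi_b1 : Psi (b_ 1) = (1, 1, true).
Proof. by rewrite Psi_gen /wrec_val /= inordK. Qed.

Let Psi_bS j : 0 < j -> j < k -> Psi (b_ j.+1) = wat (y_ j) (b_ j).
Proof.
move=> j0 jk; rewrite Psi_gen /wrec_val /= inordK ?prednK //= (gtn_eqF j0).
by case: (y_ j).
Qed.

Let Psi_b1X (e : bool) : Psi (b_ 1 ^+ e) = (1, 1, e).
Proof. by case: e; [exact: Psi_b1 | exact: morph_one PsiM]. Qed.

Let watJ c e x : wat c x ^ (1, 1, e) = wat (c (+) e) x.
Proof. by case: c; case: e; rewrite /wat conjgE /= /mul /= !mulg1 ?mul1g ?mulVg ?invg1 ?mul1g. Qed.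

Let wpairJ (g0 g1 h0 h1 : F) : wpair g0 g1 ^ wpair h0 h1 = wpair (g0 ^ h0) (g1 ^ h1).
Proof. by []. Qed.

Let wpairJs (g0 g1 : F) e :
  wpair g0 g1 ^ (1, 1, e) = if e then wpair g1 g0 else wpair g0 g1.
Proof. by case: e; rewrite /wpair conjgE /= /mul /= ?mulg1 ?mul1g ?invg1 ?mul1g. Qed.

Let Psi_bJ j e : 0 < j -> j < k -> Psi (b_ j.+1 ^ (b_ 1 ^+ (y_ j (+) e))) = wat e (b_ j).
Proof. by move=> j0 jk; rewrite PsiJ Psi_bS // Psi_b1X watJ addbA addbb. Qed.

Let Psi_a1 : Psi (a_ 1 ^ (b_ 1 ^+ y_ k)) = wpair (b_ k) (a_ n).
Proof.
rewrite PsiJ Psi_b1X Psi_gen /wrec_val /= mod0n inordK //=.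
by case: (y_ k); rewrite /wpair conjgE /= /mul /= !mulg1 ?mul1g ?invg1 ?mul1g.
Qed.

Let natF_Psi x :
  natF x = tree_wr (let: (x0, x1, e) := Psi x in (natF x0, natF x1, e)).
Proof.
have tM (p p' : wreath tree_aut) : tree_wr (p * p') = tree_wr p * tree_wr p'.
  apply/tree_autP => -[|c u]; case: p => [[? ?] e]; case: p' => [[? ?] e'] /=.
    by rewrite /tree_wr_act /=; case: e.
  by rewrite /tree_wr_act /=; case: e; case: c; case: e'.
pose h x := tree_wr (let: (x0, x1, e) := Psi x in (natF x0, natF x1, e)).
have hM : {morph h : x y / x * y}.
  move=> y z; rewrite /h PsiM -tM; congr tree_wr.
  case: (Psi y) => [[? ?] []]; case: (Psi z) => [[? ?] ?];
    by rewrite /mul /= !natFM.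
have hg g : h (F_gen g) = natF (F_gen g).
  rewrite natF_gen gen_autE /h Psi_gen /wrec_val; case: (wrec g) => [[g0 g1] e].
  congr tree_wr; case: g0 => [g0|]; case: g1 => [g1|] /=;
    by rewrite ?natF_gen ?(morph_one natFM).
rewrite -/(h x) -[x]quot_reprK; case: (quot_repr x) => u ru.
have -> : FreeGroup ru = \prod_(a <- u) letter_val (@free_gen _) a.
  elim: u ru => [|a u IH] ru; first by apply: val_inj; rewrite big_nil.
  have ru' : reduced u by apply: path_sorted ru.
  rewrite big_cons -(IH ru'); apply: val_inj; rewrite /letter_val; case: a ru => a e ru.
  by case: e ru => ru /=; case: u ru {IH} ru' => [|b u] //= /andP[/negbTE ->] _ _.
elim: u {ru} => [|a u IH].
  by rewrite big_nil (morph_one natFM) (morph_one hM).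
rewrite big_cons [quot_proj _ _]quot_projM natFM hM IH; congr (_ * _).
case: a => a [] /=; last exact/esym/hg.
rewrite /letter_val /= (morphV (@quot_projM _ F_rels)).
by rewrite (morphV natFM) (morphV hM) [in RHS]hg.
Qed.

Let natF_eq1 x : Psi x = 1 -> natF x = 1.
Proof.
move=> Px; rewrite natF_Psi Px -[X in tree_wr X]/(natF 1, natF 1, false).
rewrite (morph_one natFM).
by apply/tree_autP => -[|[] u].
Qed.

Let gen1 (S : set F) x : S x -> gen_subgroup S x.
Proof. exact: sub_gen_smallest. Qed.

Let genV (S : set F) x : gen_subgroup S x -> gen_subgroup S x^-1.
Proof.
move=> Sx H HH; have [[H1 HB] _] := HH.
by rewrite -div1g; apply: HB => //; apply: Sx.
Qed.

Let genM (S : set F) x y :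
  gen_subgroup S x -> gen_subgroup S y -> gen_subgroup S (x * y).
Proof.
move=> Sx /genV Sy H HH; have [[_ HB] _] := HH.
by rewrite -[y]invgK; apply: HB; [exact: Sx | exact: Sy].
Qed.

Let gen_1 (S : set F) : gen_subgroup S 1.
Proof. by move=> H [[]]. Qed.

Let genX (S : set F) x (e : bool) : gen_subgroup S x -> gen_subgroup S (x ^+ e).
Proof. by case: e => // _; apply: gen_1. Qed.

Let genXg (S : set F) x (e : bool) : S x -> gen_subgroup S (x ^+ e).
Proof. by move=> Sx; apply: genX; apply: gen1. Qed.

Let genJ (S : set F) x y : gen_subgroup S x -> gen_subgroup S y -> gen_subgroup S (x ^ y).
Proof. by move=> Sx Sy; rewrite conjgE; apply: genM (genV Sy) (genM Sx Sy). Qed.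

Let gen_lift (S T : set F) s :
  (forall x, S x -> exists2 y, gen_subgroup T y & Psi y = wpair 1 x) ->
  gen_subgroup S s -> exists2 y, gen_subgroup T y & Psi y = wpair 1 s.
Proof.
move=> ST Ss.
apply: (Ss [set x | exists2 y, gen_subgroup T y & Psi y = wpair 1 x]).
split; last exact: ST.
split; first by exists 1; [exact: gen_1 | exact: morph_one PsiM].
move=> x1 x2 [y Ty Ey] [z Tz Ez]; exists (y / z); first exact: genM Ty (genV Tz).
rewrite PsiM (morphV PsiM) Ey Ez /wpair /=.
by rewrite -[LHS]/(1 * 1^-1, _ * _, false) mulgV.
Qed.

Let choice_t (S T : set F) s :
  (forall x, S x -> exists2 y, gen_subgroup T y & Psi y = wpair 1 x) ->
  T (b_ 1) -> gen_subgroup S s ->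
  exists2 t, gen_subgroup T t & Psi (a_ 1 ^ t) = wpair (b_ k) (a_ n ^ s).
Proof.
move=> ST Tb /(gen_lift ST) [y Ty Ey]; exists (b_ 1 ^+ y_ k * y).
  by apply: genM => //; exact: genXg.
by rewrite conjgM PsiJ Psi_a1 Ey wpairJ conjg1.
Qed.

Let lift_b (T : set F) j : 0 < j -> j < k -> T (b_ 1) -> T (b_ j.+1) ->
  exists2 y, gen_subgroup T y & Psi y = wpair 1 (b_ j).
Proof.
move=> j0 jk T1 Tj; exists (b_ j.+1 ^ (b_ 1 ^+ (y_ j (+) true))).
  by apply: genJ; [exact: gen1 | exact: genXg].
by rewrite Psi_bJ.
Qed.

Let Psi_aS i : 0 < i -> i < n -> Psi (a_ i.+1) = wat (x_ i) (a_ i).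
Proof.
move=> i0 i_n; rewrite Psi_gen /wrec_val wrecA // modn_small // (gtn_eqF i0).
rewrite /xc modn_small; last by apply: leq_ltn_trans (leq_pred _) i_n.
by rewrite /letter; case: (nth _ _ _).
Qed.

Let wat_comm c x y : wat c x * wat (~~ c) y = wat (~~ c) y * wat c x.
Proof.
by case: c; rewrite /wat /wpair -[LHS]/(_ * _, _ * _, false)
  -[RHS]/(_ * _, _ * _, false) !mulg1 !mul1g.
Qed.

Let commg_eq1 (H : groupType) (x y : H) : x * y = y * x -> [~ x, y] = 1.
Proof. by move=> xy; apply/eqP/commgP. Qed.

Lemma good_choice_exists : exists s t m, good_choice s t m.
Proof.
have [k2|k1] := leqP 2 k; last first.
  have {k1} k1 : k = 1%N by apply/eqP; rewrite eqn_leq w_gt0 -ltnS k1.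
  have n2 : 2 <= n by move: not11 v_gt0; rewrite k1; case: (n) => [|[|]].
  exists 1, (b_ 1 ^+ y_ k), 2; apply: GoodChoice1N => //; first exact: genXg.
  by rewrite Psi_a1 k1.
have [n2|n1] := leqP 2 n.
  pose s := b_ 1 ^+ (x_ n.-1 (+) ~~ y_ k.-1).
  have Ss : gen_subgroup [set b_ 1] s by exact: genXg.
  have [||t Tt Et] := choice_t (T := [set b_ 1; b_ 2]) _ _ Ss; [|by left|].
    by move=> x ->; apply: lift_b => //; [left|right].
  exists s, t, 1%N; apply: GoodChoiceKN => //; apply: natF_eq1.
  rewrite (morph_comm PsiM); apply: commg_eq1.
  rewrite PsiJ -[in a_ n](prednK v_gt0) -[in b_ k](prednK w_gt0).
  rewrite Psi_aS ?Psi_bS ?prednK // -1?ltnS ?prednK //.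
  rewrite Psi_b1X watJ addbA addbb addFb.
  by rewrite -[X in wat X (b_ _)]negbK wat_comm negbK.
have {n1} n1 : n = 1%N by apply/eqP; rewrite eqn_leq v_gt0 -ltnS n1.
have [k3|k2'] := leqP 3 k; last first.
  have {k2'} k2' : k = 2%N by apply/eqP; rewrite eqn_leq k2 -ltnS k2'.
  pose r := b_ 1 ^+ y_ 1; pose s := b_ 1 ^+ (y_ 1 (+) y_ 2).
  have Ss : gen_subgroup [set b_ 1] s by exact: genXg.
  have [||t Tt Et] := choice_t (T := [set b_ 1; b_ 2]) _ _ Ss; [|by left|].
    by move=> x ->; apply: lift_b => //; [left|right].
  exists s, t, 2; apply: (@GoodChoice21 r) => //.
  - exact: genXg.
  - rewrite natF_Psi PsiJ Psi_bS // Psi_b1X watJ addbb /=.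
    by rewrite natF_gen (morph_one natFM).
  - have -> : r * s = b_ 1 ^+ y_ k.
      rewrite k2' /r /s; case: (y_ 1); case: (y_ 2) => //=; rewrite ?mul1g ?mulg1 //.
      exact: F_gen2.
    by rewrite natF_Psi Psi_a1 /= !natF_gen k2' n1.
  - by rewrite Et k2' n1.
pose c := y_ k.-1.
pose h := (b_ 2 ^ (b_ 1 ^+ (y_ 1 (+) c))) ^+ (y_ k.-1 (+) ~~ y_ k.-2).
pose s := b_ 1 ^+ (y_ k (+) c) * h.
have Ss : gen_subgroup [set b_ 1; b_ 2] s.
  apply: genM; first by apply: genXg; left.
  by apply: genX; apply: genJ; [apply: gen1; right | apply: genXg; left].
have [||t Tt Et] := choice_t (T := [set b_ 1; b_ 2; b_ 3]) _ _ Ss.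
- by move=> x [->|->]; apply: lift_b => //; do ?[by left; left|by left; right|by right].
- by left; left.
exists s, t, 1%N; apply: GoodChoiceK1 => //; last by rewrite Et n1.
set z := b_ 1 ^+ (y_ k.-1 (+) ~~ y_ k.-2).
have Psi_h : Psi h = wat c z.
  rewrite /h /z; case: (_ (+) ~~ _); first by rewrite Psi_bJ.
  by rewrite -[natexp _ _]/1 (morph_one PsiM); case: (c).
have Psi_s : Psi (a_ 1 ^ s) =
    if c then wpair (a_ n) (b_ k ^ z) else wpair (b_ k ^ z) (a_ n).
  rewrite /s; have -> : b_ 1 ^+ (y_ k (+) c) = b_ 1 ^+ y_ k * b_ 1 ^+ c.
    by case: (y_ k); case: (c) => //=; rewrite ?mul1g ?mulg1 //; exact/esym/F_gen2.
  rewrite !conjgM !(PsiJ _ h) (PsiJ _ (b_ 1 ^+ c)) Psi_a1 Psi_b1X Psi_h.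
  by rewrite wpairJs; case: (c); rewrite /wat wpairJ conjg1.
have E1 : k.-1.+1 = k by rewrite prednK.
have E2 : k.-2.+1 = k.-1 by rewrite prednK // -ltnS E1.
have Psi_k : Psi (b_ k) = wat (y_ k.-1) (b_ k.-1).
  by have := @Psi_bS k.-1; rewrite E1; apply; rewrite // -ltnS E1.
have Psi_k1 : Psi (b_ k.-1) = wat (y_ k.-2) (b_ k.-2).
  have := @Psi_bS k.-2; rewrite E2; apply; last first.
    exact: leq_pred.
  by rewrite -ltnS E2 -ltnS E1.
have natF_z : natF [~ b_ k ^ z, b_ k.-1] = 1.
  apply: natF_eq1; rewrite (morph_comm PsiM); apply: commg_eq1.
  have -> : Psi (b_ k ^ z) = wat (~~ y_ k.-2) (b_ k.-1).
    by rewrite PsiJ /z Psi_b1X Psi_k watJ addbA addbb.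
  rewrite Psi_k1.
  by rewrite -[X in _ * wat X _]negbK wat_comm negbK.
have Psi_comm : Psi [~ a_ 1 ^ s, b_ k] = wat c [~ b_ k ^ z, b_ k.-1].
  rewrite (morph_comm PsiM) Psi_s Psi_k -/c; case: (c); rewrite /wat.
    by rewrite -[LHS]/(wpair [~ _, 1] [~ _, _]) commg1.
  by rewrite -[LHS]/(wpair [~ _, _] [~ _, 1]) commg1.
rewrite natF_Psi Psi_comm /wat; case: (c) => /=; rewrite natF_z (morph_one natFM);
  by apply/tree_autP => -[|[] u].
Qed.

End ChoicesExist.
End WellDefined.

End KneadingGroup.

Arguments phibar {w v} s t m c.
Arguments calR {w v} s t m _.

(* Main.v *)
From HB Require Import structures.
Require Import Defs.
From mathcomp Require Import all_boot.
From mathcomp Require Import boolp classical_sets.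

Set Implicit Arguments.
Unset Strict Implicit.
Unset Printing Implicit Defensive.

Local Open Scope classical_set_scope.
Local Open Scope group_scope.

(** Write alpha = a_n ^ s, beta = b_k, u = a_1 ^ t, let N be the kernel of the
    map from F onto the quotient of Fbar by the relators phi^l(R), and write
    <<g0, g1>> for an element of the wreath product that fixes the first level.
    The content of the theorem is that N is the kernel of natF : F -> K(w, v).

    Everything rests on the identity Psi (phi x) = <<x, theta x>> [Psi_phi],
    where the endomorphism theta exchanges alpha and beta, sends a_n to beta
    and kills every other generator. Its image lies in the dihedral group
    <alpha, beta>, in which (alpha beta)^(2^m) dies in every quotient of
    interest. There the group has order dividing 4 (m = 1) or 8 (m = 2), which
    is so small that theta (phi^l(r)) becomes trivial for every relator r,
    whether r is a power of alpha beta or lies in R [collapse_rel, collapse_R].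

    Relators are trivial in K(w, v) [natF_rel, natF_R]. The elements of R have
    trivial image under Psi, because the parity condition on g puts the sections
    of the two commuting factors at different vertices. Then induction on l
    applies, as the sections of phi^(l+1)(r) are phi^l(r) and theta (phi^l(r)).

    Conversely, N is closed under taking preimages by Psi: if Psi g = <<g0, g1>>
    with g0 and g1 in N then g is in N [pi_Psi_eq1]. Indeed g can be recovered
    from its sections modulo N, as phi(g0) phi(z)^b_1 with
    z = theta(g0)^-1 g1 [recovered_all]. This is proved by multiplying g by
    generators on the right. The relations R make elements phi(x) with x in the
    kernel of theta commute with the conjugates by b_1 of such elements, and the
    choice of s and t enters through phi(alpha) = u ^ b_1 modulo N
    [pi_phi_alpha].

    Finally the kernel of natF is contained in any normal subgroup closed under
    such preimages [contraction], because each of its elements has only trivial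
    sections at some deep level. Sections of words do not grow, and a word
    whose length never drops along a path consists of letters a_i that follow
    the path together; then their indices differ by periods of v, so that they
    commute in F by definition, and such a word is visibly trivial in F once it
    is trivial in K(w, v). *)

(** * Groups generated by involutions *)

Section GroupGeneralities.
Variable G : groupType.
Implicit Types (S : set G) (x y z : G).

Lemma gen_subgroup_subgroup S : is_subgroup (gen_subgroup S).
Proof.
split=> [H [[]] //|x y Sx Sy H HH]; have [[_ HB] _] := HH.
by apply: HB; [apply: Sx | apply: Sy].
Qed.

Lemma subgroupV (H : set G) x : is_subgroup H -> H x -> H x^-1.
Proof. by case=> H1 HB Hx; rewrite -div1g; apply: HB. Qed.

Lemma subgroupM (H : set G) x y : is_subgroup H -> H x -> H y -> H (x * y).
Proof.
move=> sH Hx Hy; rewrite -[y]invgK; case: (sH) => _; apply=> //.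
exact: subgroupV.
Qed.

Lemma mem_gen_subgroup S x : S x -> gen_subgroup S x.
Proof. exact: sub_gen_smallest. Qed.

Lemma gen_subgroup_sub S (H : set G) :
  is_subgroup H -> S `<=` H -> gen_subgroup S `<=` H.
Proof. by move=> sH SH x; apply; split. Qed.

Lemma invol_inv x : x * x = 1 -> x^-1 = x.
Proof. exact: mulg1_eq. Qed.

(** Involutions generate as a monoid, so that induction only has to deal with
    right multiplication by generators. *)
Lemma gen_invol_ind S (P : G -> Prop) :
  (forall y, S y -> y * y = 1) -> P 1 ->
  (forall x y, P x -> S y -> P (x * y)) -> forall x, gen_subgroup S x -> P x.
Proof.
move=> S2 P1 PS x /(_ [set x | forall z, P z -> P (z * x) /\ P (z / x)]).
move=> Px; rewrite -[x]mul1g; apply: (Px _ _ P1).1; split; last first.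
  by move=> y Sy z Pz; rewrite (invol_inv (S2 y Sy)); split; apply: PS.
split=> [z Pz|y1 y2 H1 H2 z Pz]; first by rewrite divg1 mulg1.
rewrite invgM invgK !mulgA; split; first exact: (H2 _ (H1 _ Pz).1).2.
exact: (H1 _ (H2 _ Pz).1).2.
Qed.

Lemma involJ x y : x * x = 1 -> x ^ y * x ^ y = 1.
Proof. by move=> xx; rewrite -conjMg xx conj1g. Qed.

Lemma commuteJ x y z : commute (x ^ z) (y ^ z) <-> commute x y.
Proof.
rewrite /commute -!conjMg; split=> [|-> //]; exact: conjg_inj.
Qed.

End GroupGeneralities.

(** * Dihedral groups of order dividing 8 *)

Section SmallDihedral.
Variables (G : groupType) (A B Z : G).
Hypotheses (A2 : A * A = 1) (B2 : B * B = 1).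
Hypotheses (ZAB : Z = (A * B) * (A * B)) (Z2 : Z * Z = 1).
Let D := gen_subgroup [set A; B].

Let VA : A^-1 = A := invol_inv A2.
Let VB : B^-1 = B := invol_inv B2.

Let D_ind (P : G -> Prop) : P 1 -> (forall x, P x -> P (x * A)) ->
  (forall x, P x -> P (x * B)) -> forall x, D x -> P x.
Proof.
move=> P1 PA PB; apply: gen_invol_ind => // [y [->|->] //|x y Px [->|->]];
  by [apply: PA | apply: PB].
Qed.

Let ZE : Z = (B * A) * (B * A).
Proof. by rewrite -[LHS](invol_inv Z2) ZAB !invgM VA VB. Qed.

Let ZA : commute Z A.
Proof.
by rewrite /commute {1}ZE ZAB !mulgA -(mulgA _ A A) A2 mulg1 mul1g.
Qed.

Let ZB : commute Z B.
Proof.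
by rewrite /commute {2}ZE ZAB !mulgA -(mulgA _ B B) B2 mulg1 mul1g.
Qed.

Lemma dihedral_central x : D x -> commute Z x.
Proof.
by move: x; apply: D_ind => [|x Zx|x Zx]; [exact: commute1|..]; apply: commuteM.
Qed.

Let near x y := y = x \/ y = x * Z.

Let nearM x x' y y' : commute Z y -> near x x' -> near y y' ->
  near (x * y) (x' * y').
Proof.
move=> Zy [->|->] [->|->]; rewrite /near -!mulgA; [by left|by right|right|left].
  by rewrite Zy.
by rewrite [Z * _]mulgA Zy -!mulgA Z2 mulg1.
Qed.

Let near_gen C : C = A \/ C = B -> forall x, D x -> near x (x ^ C).
Proof.
have BA : B ^ A = B * Z by rewrite conjgE VA ZE !mulgA B2 mul1g.
have AB : A ^ B = A * Z by rewrite conjgE VB ZAB !mulgA A2 mul1g.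
have AA (x : G) : x ^ x = x by rewrite conjgE mulKg.
move=> HC; apply: D_ind => [|x Hx|x Hx]; first by rewrite conj1g; left.
  by rewrite conjMg; apply: nearM => //; case: HC => ->; rewrite ?AA ?AB; [left|right].
by rewrite conjMg; apply: nearM => //; case: HC => ->; rewrite ?AA ?BA; [right|left].
Qed.

(** The commutator subgroup is generated by the central element Z. The case
    Z = 1, the Klein four-group, is allowed, so that both values of m can be
    treated together. *)
Lemma dihedral_conj x y : D x -> D y -> x ^ y = x \/ x ^ y = x * Z.
Proof.
move=> Dx; move: y.
have near_trans y C : near x (x ^ y) -> C = A \/ C = B -> near x (x ^ (y * C)).
  move=> xy HC; rewrite conjgM.
  have ZC : Z ^ C = Z by rewrite conjgE; case: HC => ->; rewrite ?ZA ?ZB mulKg.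
  case: xy => ->; first exact: near_gen.
  rewrite conjMg ZC; case: (near_gen HC Dx) => ->; [by right|left].
  by rewrite -mulgA Z2 mulg1.
apply: D_ind => [|y xy|y xy]; first by rewrite conjg1; left.
  by apply: near_trans xy _; left.
by apply: near_trans xy _; right.
Qed.

Lemma dihedral_sqr x : D x -> x * x = 1 \/ x * x = Z.
Proof.
move=> Dx; suff: D x /\ (x * x = 1 \/ x * x = Z) by case.
have step y C : D y /\ (y * y = 1 \/ y * y = Z) -> C * C = 1 -> C = A \/ C = B ->
    D (y * C) /\ (y * C * (y * C) = 1 \/ y * C * (y * C) = Z).
  move=> [Dy y2] C2 HC; split.
    apply: subgroupM (gen_subgroup_subgroup _) Dy _.
    by apply: mem_gen_subgroup; case: HC; [left|right].
  have -> : y * C * (y * C) = y * y ^ C by rewrite conjgE (invol_inv C2) !mulgA.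
  case: (near_gen HC Dy) => ->; first exact: y2.
  rewrite mulgA; case: y2 => ->; [right|left]; by rewrite ?mul1g ?Z2.
move: x Dx; apply: D_ind => [|x Hx|x Hx].
- by split; [case: (gen_subgroup_subgroup [set A; B]) | left; rewrite mul1g].
- by apply: step => //; left.
- by apply: step => //; right.
Qed.

End SmallDihedral.

(** * Words and generators *)

Lemma tree_wrM : {morph tree_wr : p p' / p * p'}.
Proof.
move=> p p'; apply/tree_autP => -[|c u]; case: p => [[? ?] e]; case: p' => [[? ?] e'] /=.
  by rewrite /tree_wr_act /=; case: e.
by rewrite /tree_wr_act /=; case: e; case: c; case: e'.
Qed.

Section Kneading.
Variables w v : seq bool.
Hypotheses (w_gt0 : (0 < size w)%N) (v_gt0 : (0 < size v)%N).
Hypothesis last_neq : letter w (size w) != letter v (size v).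

Local Notation k := (size w).
Local Notation n := (size v).
Local Notation y_ := (letter w).
Local Notation x_ := (letter v).
Local Notation q := (n %/ root_exponent v).
Local Notation b_ j := (F_gen (genB w v j)).
Local Notation a_ i := (F_gen (genA w v i)).
Local Notation FM := (F w v).

Definition wordF (W : seq (gen w v)) : FM := \prod_(g <- W) F_gen g.

Lemma wordF_cons g W : wordF (g :: W) = F_gen g * wordF W.
Proof. exact: big_cons. Qed.

Lemma wordF_cat W1 W2 : wordF (W1 ++ W2) = wordF W1 * wordF W2.
Proof. exact: big_cat. Qed.

Lemma wordF_surj x : exists W, x = wordF W.
Proof.
have projM := @quot_projM _ (@F_rels w v).
rewrite -[x]quot_reprK; case: (quot_repr x) => u ru.
have -> : FreeGroup ru = \prod_(a <- u) letter_val (@free_gen _) a.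
  elim: u ru => [|a u IH] ru; first by apply: val_inj; rewrite big_nil.
  have ru' : reduced u by apply: path_sorted ru.
  rewrite big_cons -(IH ru'); apply: val_inj; rewrite /letter_val; case: a ru => a e ru.
  by case: e ru => ru /=; case: u ru {IH} ru' => [|b u] //= /andP[/negbTE ->] _ _.
exists (map fst u); rewrite /wordF big_map.
elim: u {ru} => [|a u IH]; first by rewrite !big_nil (morph_one projM).
rewrite !big_cons projM IH; congr (_ * _); case: a => a [] //=.
by rewrite /letter_val /= (morphV projM) (invol_inv (F_gen2 a)).
Qed.

Lemma eq_morphF (G : groupType) (f g : FM -> G) :
  {morph f : x y / x * y} -> {morph g : x y / x * y} ->
  (forall h, f (F_gen h) = g (F_gen h)) -> f =1 g.
Proof.
move=> fM gM fg x; have [W ->] := wordF_surj x.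
rewrite /wordF; elim: W => [|h W IH].
  by rewrite big_nil (morph_one fM) (morph_one gM).
by rewrite big_cons fM gM fg IH.
Qed.

(** The homomorphisms needed out of F send all the a_i into an abelian group,
    which takes care of the commutation relations whatever the periods of v. *)
Section Extension.
Variables (G : groupType) (f : gen w v -> G).
Hypotheses (f2 : forall g, f g * f g = 1)
  (fC : forall i i', commute (f (inr i)) (f (inr i'))).

Let f_rels : forall r, F_rels r -> free_lift f r = 1.
Proof. by apply: F_rels_lift => // i l _; apply: fC. Qed.

Lemma extM : {morph pres_lift (rels := @F_rels w v) f : x y / x * y}.
Proof. exact: pres_liftM. Qed.

Lemma ext_gen g : pres_lift (rels := @F_rels w v) f (F_gen g) = f g.
Proof. exact: pres_lift_gen. Qed.
End Extension.

(** The generators other than b_1 and a_1 are the successors of those other than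
    b_k and a_n, and the wreath recursion moves back along successors. In these
    terms b's and a's are treated alike, and R is a single family of commutators
    of successors. *)
Definition last_gen (g : gen w v) : bool :=
  match g with inl j => j.+1 == k | inr i => i.+1 == n end.

Definition next_gen (g : gen w v) : gen w v :=
  match g with inl j => genB w v j.+2 | inr i => genA w v i.+2 end.

Definition gen_letter (g : gen w v) : bool :=
  match g with inl j => y_ j.+1 | inr i => x_ i.+1 end.

Lemma ltn_predS (l m : nat) : (0 < l)%N -> (m < l)%N -> (m < l.-1.+1)%N.
Proof. by move/prednK->. Qed.

Lemma ordB_lt (j : 'I_k.-1.+1) : (j < k)%N.
Proof. by rewrite -[X in (_ < X)%N](prednK w_gt0). Qed.

Lemma ordA_lt (i : 'I_n.-1.+1) : (i < n)%N.
Proof. by rewrite -[X in (_ < X)%N](prednK v_gt0). Qed.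

Lemma genBE (j : 'I_k.-1.+1) : genB w v j.+1 = inl j.
Proof. by rewrite /genB /= inord_val. Qed.

Lemma genAE (i : 'I_n.-1.+1) : genA w v i.+1 = inr i.
Proof. by rewrite /genA /= modn_small ?ordA_lt // inord_val. Qed.

Lemma genAS : genA w v n.+1 = genA w v 1.
Proof. by apply: genA_modn; rewrite /= modnn mod0n. Qed.

Lemma last_genP g : last_gen g -> g = genB w v k \/ g = genA w v n.
Proof.
by case: g => [j|i] /= /eqP E; [left; rewrite -(genBE j) E|right; rewrite -(genAE i) E].
Qed.

Lemma last_genB : last_gen (genB w v k).
Proof. by rewrite /= inordK prednK. Qed.

Lemma last_genA : last_gen (genA w v n).
Proof.
have E : n.-1 %% n = n.-1 by rewrite modn_small ?prednK.
by rewrite /= E inordK prednK.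
Qed.

Lemma nonlast_ltB j : ~~ last_gen (inl j) -> (j.+1 < k)%N.
Proof. by move=> nj; rewrite ltn_neqAle nj ordB_lt. Qed.

Lemma nonlast_ltA i : ~~ last_gen (inr i) -> (i.+1 < n)%N.
Proof. by move=> ni; rewrite ltn_neqAle ni ordA_lt. Qed.

Lemma genP g : [\/ g = genB w v 1, g = genA w v 1 |
  exists2 h, ~~ last_gen h & g = next_gen h].
Proof.
case: g => [[[|j] lj]|[[|i] li]].
- by constructor 1; rewrite -genBE.
- constructor 3; have lj' : (j < k.-1.+1)%N by apply: ltnW.
  exists (inl (Ordinal lj')); last by rewrite -genBE.
  by rewrite /= neq_ltn; apply/orP; left; rewrite -[X in (_ < X)%N]prednK.
- by constructor 2; rewrite -genAE.
constructor 3; have li' : (i < n.-1.+1)%N by apply: ltnW.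
exists (inr (Ordinal li')); last by rewrite -genAE.
by rewrite /= neq_ltn; apply/orP; left; rewrite -[X in (_ < X)%N]prednK.
Qed.

Lemma wrec_next g : ~~ last_gen g -> wrec (next_gen g) =
  if gen_letter g then (None, Some g, false) else (Some g, None, false).
Proof.
case: g => [j|i] ng /=.
  have lj := ltn_predS w_gt0 (nonlast_ltB ng).
  by rewrite inordK //= genBE.
have li := nonlast_ltA ng.
by rewrite modn_small // (inordK (ltn_predS v_gt0 li)) /= genAE.
Qed.

Lemma wreathME (x0 x1 y0 y1 : FM) e f :
  ((x0, x1, e) : wreath FM) * ((y0, y1, f) : wreath FM) =
  if e then (x0 * y1, x1 * y0, ~~ f) else (x0 * y0, x1 * y1, f).
Proof. by []. Qed.

Lemma PsiJ (x y : FM) : Psi (x ^ y) = Psi x ^ Psi y.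
Proof. exact: morph_conj (PsiM v_gt0 last_neq) _ _. Qed.

Lemma Psi_b1 : Psi (b_ 1) = (1, 1, true).
Proof. by rewrite Psi_gen // /wrec_val /= inordK. Qed.

Lemma Psi_next g : ~~ last_gen g -> Psi (F_gen (next_gen g)) =
  if gen_letter g then (1, F_gen g, false) else (F_gen g, 1, false).
Proof.
by move=> ng; rewrite Psi_gen // /wrec_val wrec_next //; case: ifP.
Qed.

Lemma Psi_a1 : Psi (a_ 1) = if y_ k then (a_ n, b_ k, false) else (b_ k, a_ n, false).
Proof. by rewrite Psi_gen // /wrec_val /= mod0n inordK //=; case: ifP. Qed.

Lemma wreath_conj_flip (x0 x1 : FM) :
  ((x0, x1, false) : wreath FM) ^ ((1, 1, true) : wreath FM) = (x1, x0, false).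
Proof.
by rewrite conjgE -[LHS]/(1^-1 * (x1 * 1), 1^-1 * (x0 * 1), false) invg1 !mul1g !mulg1.
Qed.

Lemma natF_Psi (x : FM) :
  natF x = tree_wr (let: (x0, x1, e) := Psi x in (natF x0, natF x1, e)).
Proof.
have nM := natFM v_gt0 last_neq.
move: x; apply: eq_morphF => [//|x y|g].
  rewrite PsiM // -tree_wrM; congr tree_wr.
  by case: (Psi x) => [[? ?] []]; case: (Psi y) => [[? ?] ?]; rewrite /mul /= !nM.
rewrite natF_gen // gen_autE Psi_gen // /wrec_val; case: (wrec g) => [[g0 g1] e].
by congr tree_wr; case: g0 => [g0|]; case: g1 => [g1|] /=;
  rewrite ?natF_gen ?(morph_one nM).
Qed.

Lemma natF_eq1 (x x0 x1 : FM) e : Psi x = (x0, x1, e) ->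
  natF x = 1 <-> [/\ e = false, natF x0 = 1 & natF x1 = 1].
Proof.
move=> Px; rewrite natF_Psi Px; split=> [/tree_autP H|[-> -> ->]]; last first.
  by apply/tree_autP => -[|[] u].
have := H [:: false]; rewrite /= => -[e0 _]; rewrite e0 in H *.
by split=> //; apply/tree_autP => u; [have := H (false :: u)|have := H (true :: u)]; case.
Qed.

(** * The substitution phi and its second section *)

Definition subB : set FM :=
  gen_subgroup [set x | exists2 j, ~~ last_gen (inl j) & x = F_gen (inl j)].

Section Substitution.
Variables (s t : FM).
Hypothesis s_B : subB s.
Hypothesis t_B : gen_subgroup (range (fun j => F_gen (inl j) : FM)) t.
Hypothesis Psi_u : Psi (a_ 1 ^ t) = (b_ k, a_ n ^ s, false).

Local Notation alpha := (a_ n ^ s).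
Local Notation beta := (b_ k).
Local Notation u := (a_ 1 ^ t).
Local Notation ph := (@phi w v t).

Let phM : {morph ph : x y / x * y} := phiM v_gt0 t.

Lemma phJ x y : ph (x ^ y) = ph x ^ ph y.
Proof. exact: morph_conj phM _ _. Qed.

Lemma phi_nonlast g : ~~ last_gen g ->
  ph (F_gen g) = F_gen (next_gen g) ^ (b_ 1 ^+ gen_letter g).
Proof.
move=> ng; rewrite phi_F_gen //; case: g ng => [j|i] ng.
  by rewrite /= nonlast_ltB // expgb; case: ifP => _; rewrite ?conjg1.
by rewrite /= expgb; case: ifP => _; rewrite ?conjg1.
Qed.

Lemma phi_beta : ph beta = u.
Proof. by rewrite phi_F_gen // /= inordK ?prednK ?ltnn. Qed.

Lemma phi_an : ph (a_ n) = a_ 1 ^ (b_ 1 ^+ x_ n).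
Proof.
have E : n.-1 %% n = n.-1 by rewrite modn_small ?prednK.
rewrite phi_F_gen // /= E inordK ?prednK // genAS expgb.
by case: ifP => _; rewrite ?conjg1.
Qed.

(** The trace that phi leaves in the second coordinate of Psi. *)
Definition theta_gen (g : gen w v) : FM :=
  if last_gen g then (if g is inl _ then alpha else beta) else 1.

Definition theta : FM -> FM := pres_lift (rels := @F_rels w v) theta_gen.

Let theta_gen2 g : theta_gen g * theta_gen g = 1.
Proof.
rewrite /theta_gen; case: ifP => _; last by rewrite mulg1.
by case: g => _; rewrite ?F_gen2 // involJ ?F_gen2.
Qed.

Let theta_genC i i' : commute (theta_gen (inr i)) (theta_gen (inr i')).
Proof. by rewrite /commute /theta_gen; do 2!case: ifP => _; rewrite ?mulg1 ?mul1g. Qed.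

Lemma thetaM : {morph theta : x y / x * y}.
Proof. exact: extM. Qed.

Lemma theta_F_gen g : theta (F_gen g) = theta_gen g.
Proof. exact: ext_gen. Qed.

Lemma theta_nonlast g : ~~ last_gen g -> theta (F_gen g) = 1.
Proof. by rewrite theta_F_gen /theta_gen => /negbTE ->. Qed.

Lemma theta_B x : subB x -> theta x = 1.
Proof.
move: x; apply: gen_invol_ind => [y [j _ ->]||x y x1 [j nj ->]]; first exact: F_gen2.
  exact: morph_one thetaM.
by rewrite thetaM x1 theta_nonlast // mulg1.
Qed.

Lemma theta_an : theta (a_ n) = beta.
Proof. by rewrite theta_F_gen /theta_gen last_genA. Qed.

Lemma theta_alpha : theta alpha = beta.
Proof. by rewrite (morph_conj thetaM) (theta_B s_B) conjg1 theta_an. Qed.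

Lemma theta_beta : theta beta = alpha.
Proof. by rewrite theta_F_gen /theta_gen last_genB. Qed.

Lemma alpha2 : alpha * alpha = 1.
Proof. by rewrite involJ ?F_gen2. Qed.

Lemma theta_D x : gen_subgroup [set alpha; beta] (theta x).
Proof.
have sD := gen_subgroup_subgroup [set alpha; beta].
have [W ->] := wordF_surj x; elim: W => [|g W IH].
  by rewrite /wordF big_nil (morph_one thetaM); exact: sD.1.
rewrite wordF_cons thetaM; apply: (subgroupM sD) IH.
rewrite theta_F_gen /theta_gen; case: ifP => _; last exact: sD.1.
by case: g => _; apply: mem_gen_subgroup; [left|right].
Qed.

(** phi is chosen so that the first section of phi x is x. The letters b_k and
    a_n are the ones whose images involve a_1, the only generator with two
    non-trivial sections. *)
Lemma Psi_phi x : Psi (ph x) = (x, theta x, false).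
Proof.
have PM := PsiM v_gt0 last_neq.
move: x; apply: eq_morphF => [x y|x y|g]; first by rewrite phM PM.
  by rewrite thetaM.
have [lg|ng] := boolP (last_gen g); last first.
  rewrite phi_nonlast // theta_nonlast // PsiJ Psi_next // expgb.
  by case: ifP; rewrite ?(morph_one PM) ?conjg1 // Psi_b1 wreath_conj_flip.
have [->|->] := last_genP lg; first by rewrite phi_beta theta_beta Psi_u.
rewrite phi_an theta_an PsiJ Psi_a1 expgb; move: last_neq.
by case: (y_ k); case: (x_ n) => // _;
  rewrite ?(morph_one PM) ?conjg1 // Psi_b1 wreath_conj_flip.
Qed.

(** The elements g that occur in R are words in u and b_1, sorted by the parity
    of the number of letters b_1, which decides whether g exchanges the two
    subtrees. *)
Definition wordH (c : seq bool) : FM := \prod_(i <- c) (if i then b_ 1 else u).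

Lemma wordH_cat c1 c2 : wordH (c1 ++ c2) = wordH c1 * wordH c2.
Proof. exact: big_cat. Qed.

Lemma wordH1 i : wordH [:: i] = if i then b_ 1 else u.
Proof. exact: big_seq1. Qed.

Lemma wordH_cons i c : wordH (i :: c) = (if i then b_ 1 else u) * wordH c.
Proof. exact: big_cons. Qed.

Lemma u2 : u * u = 1.
Proof. by rewrite involJ ?F_gen2. Qed.

Lemma wordH_rev c : wordH (rev c) = (wordH c)^-1.
Proof.
elim: c => [|i c IH]; first by rewrite /wordH big_nil invg1.
rewrite rev_cons -cats1 wordH_cat wordH1 wordH_cons invgM IH.
by case: i; rewrite ?(invol_inv (F_gen2 _)) ?(invol_inv u2).
Qed.

Lemma wordH_nseq (i : bool) : wordH (nseq i true) = b_ 1 ^+ i.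
Proof. by case: i; [exact: big_seq1|exact: big_nil]. Qed.

(** * Recovering an element from its sections *)

Section Lifting.
(** In the application the kernel of pi is the group N of the introduction. *)
Variables (G : groupType) (pi : FM -> G).
Hypothesis piM : {morph pi : x y / x * y}.
Hypothesis pi_phi : forall x, pi x = 1 -> pi (ph x) = 1.
Hypothesis pi_theta : forall x, pi x = 1 -> pi (theta x) = 1.
Hypothesis pi_R : forall g h c, ~~ last_gen g -> ~~ last_gen h ->
  odd (count id c) = (gen_letter g == gen_letter h) ->
  commute (pi (F_gen (next_gen g))) (pi (F_gen (next_gen h) ^ wordH c)).

Let piJ x y : pi (x ^ y) = pi x ^ pi y := morph_conj piM x y.
Let piV x : pi x^-1 = (pi x)^-1 := morphV piM x.
Let pi1 : pi 1 = 1 := morph_one piM.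

(** Conjugating successors by a suitable power of b_1 gives elements phi(x) that
    all act on the same subtree; the two cases of the parity condition in R then
    become the single condition that g exchanges the subtrees. *)
Lemma pi_commute_odd g h c : ~~ last_gen g -> ~~ last_gen h ->
  odd (count id c) ->
  commute (pi (ph (F_gen g))) (pi (ph (F_gen h) ^ wordH c)).
Proof.
move=> ng nh oc; rewrite !phi_nonlast // -!wordH_nseq.
set lg := nseq _ _; set lh := nseq _ _; rewrite -conjgM -wordH_cat.
have -> : wordH (lh ++ c) = wordH ((lh ++ c) ++ rev lg) * wordH lg.
  by rewrite [wordH (_ ++ rev _)]wordH_cat wordH_rev mulgVK.
rewrite conjgM !piJ; apply/commuteJ; rewrite -piJ; apply: pi_R => //.
rewrite !count_cat count_rev !count_nseq /= !mul1n !oddD oc !oddb.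
by case: (gen_letter g); case: (gen_letter h).
Qed.

(** phi z ^ b_1 lives on the second subtree: it should commute with everything
    of the form phi x on the first one. This may be stated for x a generator
    only, at the cost of conjugating by words that preserve the subtrees. *)
Definition cross_comm (z : FM) := forall g c, ~~ last_gen g -> ~~ odd (count id c) ->
  commute (pi (ph (F_gen g) ^ wordH c)) (pi (ph z ^ b_ 1)).

Lemma cross_comm_1 : cross_comm 1.
Proof.
by move=> g c _ _; rewrite (morph_one phM) conj1g pi1; apply: commute1.
Qed.

Lemma cross_commM x y : cross_comm x -> cross_comm y -> cross_comm (x * y).
Proof.
move=> Cx Cy g c ng ec; rewrite phM conjMg [pi (_ * _ ^ _)]piM.
by apply: commuteM; [apply: Cx|apply: Cy].
Qed.

Lemma cross_comm_gen h : ~~ last_gen h -> cross_comm (F_gen h).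
Proof.
move=> nh g c ng ec.
have -> : ph (F_gen h) ^ b_ 1 = (ph (F_gen h) ^ wordH (true :: rev c)) ^ wordH c.
  by rewrite -conjgM wordH_cons wordH_rev mulgVK.
rewrite !piJ; apply/commuteJ; rewrite -piJ; apply: pi_commute_odd => //=.
by rewrite count_rev /= ec.
Qed.

(** As phi g0 has sections g0 and theta g0, the element z is what remains to be
    produced in the second coordinate. The commutation property of z is carried
    along because it is needed to multiply by one more generator. *)
Definition recovered (g : FM) := let: (g0, g1, e) := Psi g in
  let z := (theta g0)^-1 * g1 in
  cross_comm z /\ pi (g * b_ 1 ^+ e) = pi (ph g0) * pi (ph z ^ b_ 1).

Let PM := PsiM v_gt0 last_neq.

Lemma recovered1 : recovered 1.
Proof.
rewrite /recovered (morph_one PM) /= (morph_one thetaM) invg1 mulg1.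
by split; [exact: cross_comm_1 | rewrite (morph_one phM) conj1g pi1 !mulg1].
Qed.

Lemma recovered_b1 g : recovered g -> recovered (g * b_ 1).
Proof.
rewrite /recovered PM Psi_b1; case: (Psi g) => [[g0 g1] e].
rewrite wreathME; case: e => -[Cz Ez]; rewrite !mulg1; split=> //; rewrite -Ez.
by rewrite -mulgA [b_ 1 * _]F_gen2.
Qed.

Lemma recovered_nonlast g h : ~~ last_gen h -> recovered g -> recovered (g * ph (F_gen h)).
Proof.
move=> nh; rewrite /recovered PM Psi_phi theta_nonlast //.
case: (Psi g) => [[g0 g1] e]; rewrite wreathME; case: e => -[Cz Ez]; rewrite ?mulg1.
  rewrite mulgA; move: (_ * g1) Cz Ez => z Cz Ez.
  split; first exact/cross_commM/cross_comm_gen.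
  rewrite phM conjMg [pi (_ * _ ^ _)]piM mulgA -Ez -piM; congr pi.
  by rewrite expg1 conjgE !mulgA (mulgK (b_ 1)).
rewrite thetaM theta_nonlast // mulg1; split=> //.
rewrite expg0 mulg1 in Ez; rewrite ?mulg1 phM piM Ez [pi (_ * _)]piM -!mulgA; congr (_ * _).
have := Cz h [::] nh isT; rewrite /wordH big_nil conjg1 => ->.
by [].
Qed.

Lemma next_genE g : ~~ last_gen g ->
  F_gen (next_gen g) = (b_ 1 ^+ gen_letter g) * ph (F_gen g) * (b_ 1 ^+ gen_letter g).
Proof.
move=> ng; rewrite phi_nonlast // conjgE !expgb.
by case: ifP => _; rewrite ?mulg1 ?invg1 ?mul1g // -!mulgA F_gen2 mulg1 mulVKg.
Qed.

(** Building a product of b_j's never involves u, so that such products are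
    recovered before anything is known about phi alpha. *)
Let recoveredB x := recovered x /\ let: (g0, g1, e) := Psi x in subB g0 /\ subB g1.

Let recoveredB_b1 x : recoveredB x -> recoveredB (x * b_ 1).
Proof.
case=> Lx Bx; split; first exact: recovered_b1.
rewrite PM Psi_b1; case: (Psi x) Bx => [[g0 g1] e] []; rewrite wreathME.
by case: e; rewrite !mulg1.
Qed.

Let recoveredB_phi x j : ~~ last_gen (inl j) -> recoveredB x ->
  recoveredB (x * ph (F_gen (inl j))).
Proof.
move=> nj [Lx Bx]; split; first exact: recovered_nonlast.
rewrite PM Psi_phi theta_nonlast //.
have Bj : subB (F_gen (inl j)) by apply: mem_gen_subgroup; exists j.
have BM := subgroupM (gen_subgroup_subgroup _).
case: (Psi x) Bx => [[g0 g1] e] [B0 B1]; rewrite wreathME.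
by case: e; rewrite !mulg1; split=> //; apply: BM.
Qed.

Let recoveredB_gen x : gen_subgroup (range (fun j => F_gen (inl j) : FM)) x -> recoveredB x.
Proof.
move: x; apply: gen_invol_ind => [y [j _ <-]||x y Lx [j _ <-]]; first exact: F_gen2.
  split; first exact: recovered1.
  by rewrite (morph_one PM); split; case: (gen_subgroup_subgroup
    [set x : FM | exists2 j, ~~ last_gen (inl j) & x = F_gen (inl j)]).
have [->|//|[[j'|i'] nj' E]] := genP (inl j); [exact: recoveredB_b1| |by []].
rewrite E next_genE // !expgb; case: ifP => _.
  by rewrite !mulgA; apply: recoveredB_b1; apply: recoveredB_phi => //; apply: recoveredB_b1.
by rewrite mulg1 mul1g; apply: recoveredB_phi.
Qed.

Definition switch_gen (g : gen w v) : wreath FM :=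
  if g is inl _ then (if last_gen g then (1, 1, true) else (F_gen g, 1, false)) else 1.

(** With b_k realised as the swap of F wr S_2 and the other b_j as elements of
    the first factor, x lands in the first factor and commutes with the swap. *)
Lemma subB_cent_beta x : subB x -> commute x beta -> x = 1.
Proof.
pose f := pres_lift (rels := @F_rels w v) switch_gen.
have f2 g : switch_gen g * switch_gen g = 1.
  rewrite /switch_gen; case: g => [j|i]; last exact: mulg1.
  by case: ifP => _; rewrite wreathME ?F_gen2 !mulg1.
have fC i i' : commute (switch_gen (inr i)) (switch_gen (inr i')) by [].
have fM : {morph f : y z / y * z} by apply: extM.
have fg g : f (F_gen g) = switch_gen g by apply: ext_gen.
have fB y : subB y -> f y = (y, 1, false).
  move: y; apply: gen_invol_ind => [y [j _ ->]||y z fy [j nj ->]].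
  - exact: F_gen2.
  - exact: morph_one fM.
  by rewrite fM fy fg /switch_gen (negbTE nj) wreathME mulg1.
move=> Bx xb; have : f (x * beta) = f (beta * x) by rewrite xb.
have -> : f (x * beta) = (x, 1, true).
  by rewrite fM (fB _ Bx) fg /switch_gen last_genB wreathME !mulg1.
have -> : f (beta * x) = (1, x, true).
  by rewrite fM (fB _ Bx) fg /switch_gen last_genB wreathME !mul1g.
by case.
Qed.

(** Counts the letters a_i modulo 2, the swap serving as an element of order 2. *)
Definition parity_gen (g : gen w v) : wreath FM :=
  if g is inr _ then (1, 1, true) else 1.

Lemma an_not_conj_beta x : a_ n ^ x <> beta.
Proof.
pose f := pres_lift (rels := @F_rels w v) parity_gen.
have f2 g : parity_gen g * parity_gen g = 1.
  by case: g => [j|i]; rewrite /parity_gen ?mulg1 // wreathME !mulg1.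
have fC i i' : commute (parity_gen (inr i)) (parity_gen (inr i')) by [].
have fM : {morph f : y z / y * z} by apply: extM.
have fg g : f (F_gen g) = parity_gen g by apply: ext_gen.
move=> /(congr1 f); rewrite (morph_conj fM) !fg => E.
have : parity_gen (genA w v n) = 1 by apply/eqP; rewrite -(conjg_eq1 _ (f x)) E.
by [].
Qed.

(** Both sides have sections alpha and beta, but this does not suffice since N
    is not yet known to contain the kernel of Psi. Writing u as phi(a_n) ^ t1
    with t1 a product of b_j's, the hypothesis on Psi u says that t1 exchanges
    the subtrees, that its first section conjugates a_n to alpha and that its
    second one centralises b_k, hence is trivial. Recovering t1 from these
    sections gives t1 b_1 = phi of the first section, modulo N. *)
Lemma pi_phi_alpha : pi (ph alpha) = pi (u ^ b_ 1).
Proof.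
pose t1 := (b_ 1 ^+ x_ n) * t.
have a1E : a_ 1 = ph (a_ n) ^ (b_ 1 ^+ x_ n).
  by rewrite phi_an -conjgM !expgb; case: ifP; rewrite ?F_gen2 ?mulg1 conjg1.
have uE : u = ph (a_ n) ^ t1 by rewrite /t1 conjgM -a1E.
have [] : recoveredB t1.
  apply: recoveredB_gen; apply: (subgroupM (gen_subgroup_subgroup _)) t_B.
  rewrite expgb; case: ifP => _; last first.
    by case: (gen_subgroup_subgroup (range (fun j => F_gen (inl j) : FM))).
  by apply: mem_gen_subgroup; exists (inord 0).
have := Psi_u; rewrite uE PsiJ Psi_phi theta_an /recovered.
case: (Psi t1) => [[t10 t11] []] Pt; last first.
  by case: Pt => /an_not_conj_beta.
have [Eb Ea] : beta ^ t11 = beta /\ a_ n ^ t10 = alpha by case: Pt.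
case=> _; rewrite expg1 => Et [B0 B1].
have t11E : t11 = 1 by apply: subB_cent_beta => //; rewrite /commute [in RHS]conjgC Eb.
rewrite t11E mulg1 (theta_B B0) invg1 (morph_one phM) conj1g pi1 mulg1 in Et.
by rewrite -Ea -conjgM piJ Et -piJ -phJ.
Qed.

Lemma cross_comm_alpha z : cross_comm z -> cross_comm (z ^ alpha).
Proof.
move=> Cz g c ng ec.
have -> : pi (ph (z ^ alpha) ^ b_ 1) = pi ((ph z ^ b_ 1) ^ u).
  rewrite phJ piJ [pi (_ ^ _)]piJ pi_phi_alpha -!piJ -!(conjgM (ph z)); congr (pi (_ ^ _)).
  by rewrite [RHS]conjgCV (invol_inv (F_gen2 _)).
have -> : wordH c = wordH (c ++ [:: false]) * u.
  by rewrite wordH_cat wordH1 -mulgA u2 mulg1.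
rewrite conjgM !piJ; apply/commuteJ; rewrite -!piJ; apply: Cz => //.
by rewrite count_cat oddD addbF.
Qed.

Lemma cross_comm_beta z : cross_comm z -> cross_comm (z ^ beta).
Proof.
move=> Cz g c ng ec; rewrite phJ phi_beta.
have -> : (ph z ^ u) ^ b_ 1 = (ph z ^ b_ 1) ^ wordH [:: true; false; true].
  by rewrite -!conjgM !wordH_cons /wordH big_nil mulg1 mulgA F_gen2 mul1g.
have -> : wordH c = wordH (c ++ [:: true; false; true]) * wordH [:: true; false; true].
  rewrite wordH_cat -mulgA -wordH_cat !wordH_cons /wordH big_nil mulg1.
  by rewrite !(mulgA (b_ 1) (b_ 1)) F_gen2 mul1g (mulgA u u) u2 mul1g F_gen2 mulg1.
rewrite conjgM !piJ; apply/commuteJ; rewrite -!piJ; apply: Cz => //.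
by rewrite count_cat /= oddD addbF.
Qed.

(** Conjugation of z by beta or alpha becomes conjugation of phi z ^ b_1 by
    u ^ b_1 or u, thanks to phi beta = u and the value of phi alpha. *)
Lemma recovered_u g : recovered g -> recovered (g * u).
Proof.
rewrite /recovered PM Psi_u; case: (Psi g) => [[g0 g1] e]; rewrite wreathME.
case: e => -[Cz Ez]; rewrite [theta (g0 * _)]thetaM ?theta_alpha ?theta_beta invgM.
  have -> : beta^-1 * (theta g0)^-1 * (g1 * beta) = ((theta g0)^-1 * g1) ^ beta.
    by rewrite [RHS]conjgE -(mulgA beta^-1) (mulgA (theta g0)^-1).
  move: ((theta g0)^-1 * g1) Cz Ez => z Cz; rewrite expg1 => Ez.
  split; first exact: cross_comm_beta.
  rewrite phM [pi (ph g0 * _)]piM pi_phi_alpha phJ phi_beta.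
  transitivity (pi (g * b_ 1) * pi (u ^ b_ 1)).
    by rewrite -piM -(mulgA g (b_ 1)) -conjgC -(mulgA g u).
  rewrite Ez -!(mulgA (pi (ph g0))); congr (_ * _); rewrite -!piM; congr pi.
  rewrite [LHS]conjgC; congr (_ * _).
  by rewrite -!(conjgM (ph z)); congr (_ ^ _); rewrite conjgE mulgA mulgA mulgV mul1g.
have -> : alpha^-1 * (theta g0)^-1 * (g1 * alpha) = ((theta g0)^-1 * g1) ^ alpha.
  by rewrite [RHS]conjgE -(mulgA alpha^-1) (mulgA (theta g0)^-1).
move: ((theta g0)^-1 * g1) Cz Ez => z Cz; rewrite expg0 !mulg1 => Ez.
split; first exact: cross_comm_alpha.
rewrite phM phi_beta piM Ez [pi (_ * _)]piM phJ.
rewrite [pi ((_ ^ ph alpha) ^ _)]piJ [pi (_ ^ ph alpha)]piJ.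
rewrite pi_phi_alpha -!piJ -!(mulgA (pi (ph g0))); congr (_ * _); rewrite -!piM; congr pi.
rewrite [LHS]conjgC; congr (_ * _); rewrite -!(conjgM (ph z)); congr (_ ^ _).
by rewrite [LHS]conjgCV (invol_inv (F_gen2 _)).
Qed.

Lemma recovered_all g : recovered g.
Proof.
have Lnext x h : ~~ last_gen h -> recovered x -> recovered (x * F_gen (next_gen h)).
  move=> nh Lx; rewrite next_genE // !expgb.
  case: ifP => _; last by rewrite mulg1 mul1g; apply: recovered_nonlast.
  by rewrite !mulgA; apply: recovered_b1; apply: recovered_nonlast => //; apply: recovered_b1.
have Lb x j : recovered x -> recovered (x * F_gen (inl j)).
  move=> Lx; have [->||[h nh ->]] := genP (inl j); [exact: recovered_b1|by []|exact: Lnext].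
have Lt x y : gen_subgroup (range (fun j => F_gen (inl j) : FM)) y ->
    recovered x -> recovered (x * y).
  move=> By Lx; move: y By; apply: gen_invol_ind => [y [j _ <-]||y z Ly [j _ <-]].
  - exact: F_gen2.
  - by rewrite mulg1.
  by rewrite mulgA; apply: Lb.
have La1 x : recovered x -> recovered (x * a_ 1).
  move=> Lx; have -> : a_ 1 = (t * u) * t^-1 by rewrite conjgE mulVKg mulgK.
  rewrite !(mulgA x); apply: (Lt); first exact: (subgroupV (gen_subgroup_subgroup _)) t_B.
  by apply: recovered_u; apply: Lt.
have [W ->] := wordF_surj g; rewrite -[wordF W]mul1g.
elim: W (1) recovered1 => [|h W IH] x Lx; first by rewrite /wordF big_nil mulg1.
rewrite wordF_cons mulgA; apply: IH.
have [->|->|[h' nh ->]] := genP h; [exact: recovered_b1|exact: La1|exact: Lnext].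
Qed.

(** Both factors of the recovered element are trivial: pi kills g0 and g1, hence
    also theta(g0)^-1 g1, and its kernel is stable under phi. *)
Lemma pi_Psi_eq1 g g0 g1 : Psi g = (g0, g1, false) ->
  pi g0 = 1 -> pi g1 = 1 -> pi g = 1.
Proof.
move=> Pg E0 E1; have := recovered_all g; rewrite /recovered Pg expg0 mulg1 => -[_ ->].
rewrite pi_phi // mul1g piJ pi_phi ?conj1g // piM E1 mulg1 piV pi_theta //.
exact: invg1.
Qed.

End Lifting.

(** * The relators vanish under theta and in the tree *)

Lemma iter_phM l : {morph iter l ph : x y / x * y}.
Proof. by elim: l => [//|l IH] x y; rewrite !iterS IH phM. Qed.

Lemma iter_phi_a l i : exists i' x, iter l ph (F_gen (inr i)) = F_gen (inr i') ^ x.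
Proof.
elim: l => [|l [i' [x E]]]; first by exists i, 1; rewrite conjg1.
rewrite iterS E phJ phi_F_gen // /phi_gen.
exists (inord (i'.+1 %% n)), ((b_ 1 ^+ x_ i'.+1) * ph x).
by rewrite conjgM expgb /genA /=; case: ifP => _; rewrite ?conjg1.
Qed.

(** The exceptional shape of the relators when the dihedral group below may
    fail to be abelian, namely (k, n) = (2, 1) or k = 1. *)
Definition homogeneous := forall g h, ~~ last_gen g -> ~~ last_gen h ->
  g = h \/ exists i i', g = inr i /\ h = inr i'.

(** The two homomorphisms f of interest are natF, for the relations to hold in
    K(w, v), and the projection pi, for its kernel to be stable under theta. *)
Section Collapse.
Variables (m : nat) (H : groupType) (f : FM -> H).
Hypothesis m_cases : m = 1%N \/ m = 2 /\ homogeneous.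
Hypothesis fM : {morph f : x y / x * y}.
Hypothesis f_rel : f ((alpha * beta) ^+ (2 ^ m)%N) = 1.

Let A := f alpha.
Let B := f beta.
Let Z := (A * B) * (A * B).

Let A2 : A * A = 1. Proof. by rewrite -fM alpha2 (morph_one fM). Qed.
Let B2 : B * B = 1. Proof. by rewrite -fM F_gen2 (morph_one fM). Qed.

(* for m = 1 this says that f alpha and f beta commute *)
Let Z2m : Z ^+ m = 1.
Proof.
move: f_rel; rewrite (morph_exp fM) fM -/A -/B.
by case: m_cases => [->|[-> _]]; rewrite ?(expgnA _ 2 2) expg2.
Qed.

Let Z2 : Z * Z = 1.
Proof.
by move: Z2m; case: m_cases => [->|[-> _]] //; rewrite expg1 => ->; rewrite mulg1.
Qed.

Let thetaD x : gen_subgroup [set A; B] (f (theta x)).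
Proof.
have sD := gen_subgroup_subgroup [set A; B].
apply: (@gen_subgroup_sub _ [set alpha; beta]
  [set x | gen_subgroup [set A; B] (f x)]) (theta_D x).
  split=> [|y z Dy Dz]; first by rewrite /mkset (morph_one fM); exact: sD.1.
  by rewrite /mkset fM (morphV fM); apply: sD.2.
by move=> y [->|->]; apply: mem_gen_subgroup; [left|right].
Qed.

Let conjD x y : f (theta x) ^ f (theta y) = f (theta x) \/
    f (theta x) ^ f (theta y) = f (theta x) * Z.
Proof. exact: (dihedral_conj A2 B2 erefl Z2 (thetaD x) (thetaD y)). Qed.

Let ZD x : commute Z (f (theta x)).
Proof. exact: (dihedral_central A2 B2 erefl Z2 (thetaD x)). Qed.

Let tM l : {morph f \o theta \o iter l ph : x y / x * y}.
Proof. by move=> x y /=; rewrite iter_phM thetaM fM. Qed.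

(** Fourth powers are trivial in a dihedral group of order 8, and squares are
    trivial in the Klein four-group. *)
Lemma collapse_rel l : f (theta (iter l ph ((alpha * beta) ^+ (2 ^ m)%N))) = 1.
Proof.
have x2 := dihedral_sqr A2 B2 erefl Z2 (thetaD (iter l ph (alpha * beta))).
rewrite [LHS](morph_exp (tM l)) /=; rewrite -expg2 -/Z in x2.
case: m_cases Z2m x2 => [->|[-> _]].
  by rewrite expg1 => Z1 [] E; rewrite [LHS]E.
by rewrite (expgnA _ 2 2) => _ [] ->; rewrite ?expg1n.
Qed.

(** In a dihedral group of order 8 every element commutes with its conjugates,
    and so do any two conjugates of the reflection f beta. The latter is what
    occurs when only a's are present, since phi permutes the a_i up to
    conjugacy and theta kills them all except a_n. *)
Lemma collapse_R l g h c : ~~ last_gen g -> ~~ last_gen h ->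
  f (theta (iter l ph [~ F_gen (next_gen g), F_gen (next_gen h) ^ wordH c])) = 1.
Proof.
move=> ng nh; rewrite [LHS](morph_comm (tM l)) (morph_conj (tM l)).
apply/eqP/commgP; move: (wordH c) => x /=.
set X := f _; set Y := f (theta (iter l ph (F_gen (next_gen h)))); set P := f _.
have ZP := ZD (iter l ph x); have ZY := ZD (iter l ph (F_gen (next_gen h))).
have ZX := ZD (iter l ph (F_gen (next_gen g))).
have XYZ : commute X Y -> commute X (Y ^ P).
  move=> XY; case: (conjD (iter l ph (F_gen (next_gen h))) (iter l ph x)) => -> //.
  by apply: commuteM => //; apply/commute_sym.
case: m_cases => [m1|[_ hom]].
  have Z1 : Z = 1 by move: Z2m; rewrite m1 expg1.
  apply: XYZ; apply/commgP; rewrite -conjg_fix; apply/eqP.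
  by case: (conjD (iter l ph (F_gen (next_gen g))) (iter l ph (F_gen (next_gen h))));
    rewrite -/X -/Y => ->; rewrite ?Z1 ?mulg1.
case: (hom g h ng nh) => [gh|[i [i' [gi hi]]]]; first by apply: XYZ; rewrite /X /Y gh.
have a_near j : let z := f (theta (iter l ph (F_gen (next_gen (inr j))))) in
    [\/ z = 1, z = B | z = B * Z].
  have [j' [y ->]] := iter_phi_a l (inord (j.+1 %% n)).
  rewrite (morph_conj thetaM) (morph_conj fM) theta_F_gen /theta_gen.
  case: ifP => _; last by rewrite (morph_one fM) conj1g; constructor 1.
  have := conjD alpha y; rewrite theta_alpha -/B.
  by case=> ->; [constructor 2|constructor 3].
have ZB : commute Z B by have := ZD alpha; rewrite theta_alpha.
have BBZ : commute B (B * Z) by apply: commuteM => //; apply/commute_sym.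
apply: XYZ; rewrite /X /Y gi hi.
case: (a_near i) => ->; case: (a_near i') => -> //;
  by [apply: commute1|apply/commute_sym/commute1|apply/commute_sym].
Qed.

End Collapse.

Lemma wreath_conj (x0 x1 p0 p1 : FM) e :
  ((x0, x1, false) : wreath FM) ^ ((p0, p1, e) : wreath FM) =
  if e then (x1 ^ p1, x0 ^ p0, false) else (x0 ^ p0, x1 ^ p1, false).
Proof. by case: e. Qed.

(** The sections of the two factors sit at different vertices: conjugation by g
    exchanges the vertices exactly when the letters of the factors agree. *)
Lemma Psi_R g h c : ~~ last_gen g -> ~~ last_gen h ->
  odd (count id c) = (gen_letter g == gen_letter h) ->
  Psi [~ F_gen (next_gen g), F_gen (next_gen h) ^ wordH c] = 1.
Proof.
have PM := PsiM v_gt0 last_neq.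
move=> ng nh oc; rewrite (morph_comm PM) PsiJ; apply/eqP/commgP.
have [p0 [p1 ->]] : exists p0 p1, Psi (wordH c) = (p0, p1, odd (count id c)).
  elim: c {oc} => [|i c [p0 [p1 E]]].
    by exists 1, 1; rewrite /wordH big_nil (morph_one PM).
  rewrite wordH_cons PM E; case: i; rewrite ?Psi_u ?Psi_b1 wreathME.
    by exists (1 * p1), (1 * p0).
  by exists (beta * p0), (alpha * p1).
rewrite oc !Psi_next //.
by case: (gen_letter g); case: (gen_letter h); rewrite wreath_conj /commute
  !wreathME ?conj1g ?mulg1 ?mul1g.
Qed.

Section Soundness.
Variable m : nat.
Hypothesis m_cases : m = 1%N \/ m = 2 /\ homogeneous.
Hypothesis nat_rel : natF ((alpha * beta) ^+ (2 ^ m)%N) = 1.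

Let nM := natFM v_gt0 last_neq.

Lemma natF_rel l : natF (iter l ph ((alpha * beta) ^+ (2 ^ m)%N)) = 1.
Proof.
elim: l => [//|l IH]; rewrite iterS; apply/(natF_eq1 (Psi_phi _)).
by split=> //; apply: (collapse_rel m_cases nM).
Qed.

Lemma natF_R l g h c : ~~ last_gen g -> ~~ last_gen h ->
  odd (count id c) = (gen_letter g == gen_letter h) ->
  natF (iter l ph [~ F_gen (next_gen g), F_gen (next_gen h) ^ wordH c]) = 1.
Proof.
move=> ng nh oc; elim: l => [|l IH].
  by apply/(natF_eq1 (Psi_R ng nh oc)); rewrite (morph_one nM).
rewrite iterS; apply/(natF_eq1 (Psi_phi _)).
by split=> //; apply: (collapse_R m_cases nM).
Qed.

End Soundness.
End Substitution.

(** * Consequences of the choice of s, t and m *)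

(** The square of x b_1 has sections h, h, where h is an involution. *)
Lemma Psi_next_b1_pow4 h : ~~ last_gen h ->
  Psi ((F_gen (next_gen h) * b_ 1) ^+ 4) = 1.
Proof.
have PM := PsiM v_gt0 last_neq.
move=> nh; rewrite (morph_exp PM) PM Psi_next // Psi_b1.
have E2 : ((F_gen h, F_gen h, false) : wreath FM) ^+ 2 = 1.
  by rewrite expg2 wreathME !F_gen2.
rewrite (expgnA _ 2 2) [X in X ^+ _ = _]expg2 -E2; congr (_ ^+ 2).
by case: ifP => _; rewrite !wreathME ?mulg1 ?mul1g.
Qed.

Lemma natF_next_b1_pow4 h : ~~ last_gen h ->
  natF ((F_gen (next_gen h) * b_ 1) ^+ 4) = 1.
Proof.
move=> nh; have N1 := morph_one (natFM v_gt0 last_neq).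
by apply/(natF_eq1 (Psi_next_b1_pow4 nh)); rewrite N1.
Qed.

Lemma sub_gen_subgroup (G : groupType) (S T : set G) :
  S `<=` gen_subgroup T -> gen_subgroup S `<=` gen_subgroup T.
Proof. exact: (gen_subgroup_sub (gen_subgroup_subgroup T)). Qed.

Lemma subB_b j : (0 < j < k)%N -> subB (b_ j).
Proof.
case/andP=> j0 jk; apply: mem_gen_subgroup; exists (inord j.-1) => //.
have lj : (j.-1 < k)%N by apply: leq_ltn_trans (leq_pred j) jk.
by rewrite /= (inordK (ltn_predS w_gt0 lj)) prednK // (ltn_eqF jk).
Qed.

Lemma natF_sqr_comm (x y : FM) : x * x = 1 -> y * y = 1 ->
  natF [~ x, y] = 1 -> natF ((x * y) ^+ (2 ^ 1)%N) = 1.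
Proof.
move=> x2 y2; rewrite commgEl conjgE (invol_inv x2) (invol_inv y2) expn1 expg2.
by rewrite !mulgA.
Qed.

(** The only properties of s, t and m that matter, common to the four cases of
    the choice. In the case (k, n) = (2, 1), conjugating by r turns
    a_1 ^ s b_2 into <<b_2 b_1, a_1>>, whose fourth power is trivial. *)
Lemma good_choice_facts s t m : good_choice s t m ->
  [/\ subB s, gen_subgroup (range (fun j => F_gen (inl j) : FM)) t,
      Psi (a_ 1 ^ t) = (b_ k, a_ n ^ s, false),
      natF ((a_ n ^ s * b_ k) ^+ (2 ^ m)%N) = 1 &
      m = 1%N \/ m = 2 /\ homogeneous].
Proof.
have nM := natFM v_gt0 last_neq.
have bR (T : set FM) x : gen_subgroup T x ->
    T `<=` range (fun j => F_gen (inl j) : FM) ->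
    gen_subgroup (range (fun j => F_gen (inl j) : FM)) x.
  move=> Tx TR; apply: sub_gen_subgroup Tx => y /TR; exact: mem_gen_subgroup.
have bI j : range (fun j => F_gen (inl j) : FM) (b_ j) by exists (inord j.-1).
case=> {s t m} [s t k2 n2 Ss Es Tt Et|s t k3 n1 Ss Es Tt Et|
  r s t k2 n1 Rr Ss Er Es Tt Et|t k1 n2 Tt Et].
- split=> //.
  + apply: sub_gen_subgroup Ss => _ ->; exact: subB_b.
  + by apply: bR Tt _ => _ [->|->].
  + by apply: natF_sqr_comm => //; rewrite ?involJ ?F_gen2.
  + by left.
- have an : a_ n = a_ 1 by rewrite (congr1 (genA w v) n1).
  rewrite an; split=> //.
  + by apply: sub_gen_subgroup Ss => _ [->|->]; apply: subB_b => //; apply: ltn_trans k3.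
  + by apply: bR Tt _ => _ [[->|->]|->].
  + by apply: natF_sqr_comm => //; rewrite ?involJ ?F_gen2.
  + by left.
- have an : a_ n = a_ 1 by rewrite (congr1 (genA w v) n1).
  have bk : b_ k = b_ 2 by rewrite (congr1 (genB w v) k2).
  have nb1 : ~~ last_gen (genB w v 1) by rewrite /= inordK // k2.
  have b2 : b_ 2 = F_gen (next_gen (genB w v 1)) by rewrite /= inordK.
  rewrite an bk; split=> //.
  + by apply: sub_gen_subgroup Ss => _ ->; apply: subB_b; rewrite k2.
  + by apply: bR Tt _ => _ [->|->].
  + have rs : r * s = s * r.
      have C1 x : gen_subgroup [set b_ 1 : FM] x -> commute x (b_ 1).
        move: x; apply: gen_invol_ind => [_ -> |//|x _ Cx ->]; first exact: F_gen2.
        + exact/commute_sym/commute1.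
        + by apply/commute_sym; apply: commuteM => //; apply/commute_sym.
      move: s Ss {Es Et}; apply: gen_invol_ind => [_ ->||x _ Cx ->].
      * exact: F_gen2.
      * by rewrite mulg1 mul1g.
      * by rewrite mulgA Cx -!mulgA (C1 r).
    apply: (conjg_inj (natF r)); rewrite conj1g -(morph_conj nM) conjXg conjMg.
    rewrite -conjgM -rs (morph_exp nM) nM Er Es -tree_wrM.
    have wE (x y : tree_aut) l :
        ((x, y, false) : wreath tree_aut) ^+ l = (x ^+ l, y ^+ l, false).
      by elim: l => [|l IH]; rewrite ?expgS ?IH.
    have tX p l : tree_wr p ^+ l = tree_wr (p ^+ l).
      have t1 : tree_wr 1 = 1 by apply/tree_autP => -[|[] ?].
      by elim: l => [|l IH]; rewrite ?expg0 ?t1 // !expgS IH tree_wrM.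
    rewrite tX -[wpair _ _ * _]/((gen_aut (genB w v 2) * gen_aut (genB w v 1),
      gen_aut (genA w v 1) * 1, false) : wreath tree_aut) wE mulg1.
    have -> : gen_aut (genA w v 1) ^+ (2 ^ 2) = 1.
      by rewrite (expgnA _ 2 2) [X in X ^+ _]expg2 gen_aut2 expg1n.
    have -> : (gen_aut (genB w v 2) * gen_aut (genB w v 1)) ^+ (2 ^ 2) = 1.
      by rewrite -!natF_gen // -nM -(morph_exp nM) b2 natF_next_b1_pow4.
    by apply/tree_autP => -[|[] ?].
  + right; split=> // g h ng nh; left.
    have E l : ~~ last_gen l -> l = genB w v 1.
      case: l => [j|i] nl; last by have := leq_trans (nonlast_ltA nl) (eq_leq n1).
      rewrite -genBE; congr (genB _ _ _.+1).
      by have := leq_trans (nonlast_ltB nl) (eq_leq k2); rewrite !ltnS leqn0 => /eqP.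
    by rewrite (E g) // (E h).
- have bk : b_ k = b_ 1 by rewrite (congr1 (genB w v) k1).
  rewrite conjg1 bk; split=> //.
  + by case: (gen_subgroup_subgroup
      [set x : FM | exists2 j, ~~ last_gen (inl j) & x = F_gen (inl j)]).
  + by apply: bR Tt _ => _ ->.
  + have [E|E|[h nh ->]] := genP (genA w v n); [by []| |exact: natF_next_b1_pow4].
    have := last_genA; rewrite E /= mod0n inordK // => /eqP n1.
    by rewrite -n1 in n2.
  + right; split=> // -[j|i] h ng nh; first by have := leq_trans (nonlast_ltB ng) (eq_leq k1).
    case: h nh => [j|i'] nh; last by right; exists i, i'.
    by have := leq_trans (nonlast_ltB nh) (eq_leq k1).
Qed.

(** * Sections of words, and the paths along which they do not shrink *)

Definition sec (c : bool) (g : gen w v) : option (gen w v) :=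
  let: (g0, g1, e) := wrec g in if c then g1 else g0.

Definition flip (g : gen w v) : bool := (wrec g).2.

(** The section at c of the product of a word, computed letter by letter: the
    vertex c moves whenever the letter b_1 is crossed, and trivial sections are
    dropped. *)
Fixpoint secw (c : bool) (W : seq (gen w v)) : seq (gen w v) :=
  if W is g :: W' then oapp cons id (sec c g) (secw (c (+) flip g) W') else [::].

(** A letter dies when its section is trivial; a word gets shorter along u as
    soon as one of its letters dies. *)
Fixpoint survives (u : seq bool) (g : gen w v) : bool :=
  if u is c :: u' then oapp (survives u') false (sec c g) else true.

Lemma Psi_wordF W : exists e,
  Psi (wordF W) = (wordF (secw false W), wordF (secw true W), e).
Proof.
have PM := PsiM v_gt0 last_neq.
elim: W => [|g W [e IH]]; first by exists false; rewrite /wordF !big_nil (morph_one PM).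
have ocE o W' : wordF (oapp cons id o W') = oapp (@F_gen w v) (1 : FM) o * wordF W'.
  by case: o => [h|] /=; rewrite ?wordF_cons ?mul1g.
exists (flip g (+) e); rewrite wordF_cons PM IH /= !ocE Psi_gen // /wrec_val /sec /flip.
by case: (wrec g) => [[g0 g1] []]; rewrite wreathME.
Qed.

Lemma sec_flip c g h : sec c g = Some h -> flip g = false.
Proof.
rewrite /sec /flip; case: g => [j|i] /=; first by do 2!case: ifP => //=; case: c.
by do 2!case: ifP => //=.
Qed.

Lemma size_secw c W : (size (secw c W) <= size W)%N.
Proof.
elim: W c => [//|g W IH] c /=; case: (sec c g) => [h|] /=; first by rewrite ltnS IH.
exact: leqW (IH _).
Qed.

Lemma secw_pmap c W : size (secw c W) = size W ->
  secw c W = pmap (sec c) W /\ (forall g, g \in W -> sec c g).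
Proof.
elim: W c => [//|g W IH] c /=; case E: (sec c g) => [h|] /=; last first.
  by move=> sW; have := size_secw (c (+) flip g) W; rewrite sW ltnn.
rewrite (sec_flip E) addbF => -[/IH[-> all]]; split=> // g'.
by rewrite inE => /predU1P[->|/all]; rewrite ?E.
Qed.

(** The only possible sections are b_j, b_(j-1), ..., b_1, and then nothing. *)
Lemma survives_b u j : survives u (inl j) -> (size u <= j)%N.
Proof.
elim: u j => [//|c u IH] j /=; rewrite /sec /=.
case: (posnP j) => [j0|j0]; first by rewrite j0 /=; case: c.
have bE : genB w v j = inl (inord j.-1) by [].
have jE : (inord j.-1 : 'I_k.-1.+1) = j.-1 :> nat.
  exact: inordK (leq_ltn_trans (leq_pred j) (ltn_ord j)).
by case: (y_ j); case: c; rewrite //= bE => /IH; rewrite jE -ltnS prednK.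
Qed.

Lemma sec_a c i : (0 < i)%N -> sec c (genA w v i.+1) =
  if c == xc v i then Some (genA w v i)
  else if i %% n == 0 then Some (genB w v k) else None.
Proof.
by move=> i0; rewrite /sec wrecA //=; case: (xc v i); case: c.
Qed.

Lemma survives_bk u : survives u (genB w v k) -> (size u < k)%N.
Proof.
by move/survives_b; rewrite (inordK (ltnSn _)) => /leq_ltn_trans; apply; rewrite ltn_predL.
Qed.

(** A letter a_i that leaves the cycle of a's does so through b_k, which dies
    within k steps. Hence, except near its end, the path must read the periodic
    word v backwards, starting before the index i. *)
Lemma survives_a u i p : survives u (genA w v i.+1) -> (p < i)%N ->
  (p + k < size u)%N -> nth false u p = xc v (i - p).
Proof.
elim: p u i => [|p IH] [//|c u] [//|i] /=; rewrite sec_a //; case: eqP => [E|_].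
- by rewrite subn0.
- case: ifP => //= _ /survives_bk uk _; rewrite add0n ltnS => ku.
  by have := leq_trans uk ku; rewrite ltnn.
- by rewrite ltnS addSn ltnS subSS; apply: IH.
- case: ifP => //= _ /survives_bk uk _; rewrite addSn ltnS => pu.
  by have := ltn_trans uk (leq_ltn_trans (leq_addl _ _) pu); rewrite ltnn.
Qed.

(** The gcd r of the period p and of n / d is again a period (Bezout), so v is
    the (n / r)-th power of a word. Maximality of d forces r = n / d. *)
Lemma period_dvdn p : (forall j, (0 < j)%N -> xc v (j + p) = xc v j) -> (q %| p)%N.
Proof.
move=> vp; have dq := root_exponent_dvd v_gt0.
have q0 : (0 < q)%N by have := v_gt0; rewrite -{1}dq muln_gt0 => /andP[].
pose r := gcdn p q.
have r0 : (0 < r)%N by rewrite gcdn_gt0 q0 orbT.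
have rn : (r %| n)%N by rewrite -dq dvdn_mull // dvdn_gcdr.
have vpl l j : (0 < j)%N -> xc v (j + l * p) = xc v j.
  move=> j0; elim: l => [|l IH]; first by rewrite addn0.
  by rewrite mulSn addnA -IH addnAC vp // addn_gt0 j0.
have vr j : (0 < j)%N -> xc v (j + r) = xc v j.
  move=> j0; case: (posnP p) => [p0|p0].
    by rewrite /r p0 gcd0n -[X in (_ + X)%N]mul1n xc_period.
  have [a b E _] := egcdnP q p0.
  rewrite -(xc_period v_gt0 b) ?addn_gt0 ?j0 // -addnA (addnC r) -E.
  exact: vpl.
have vrl l j : (0 < j)%N -> xc v (j + l * r) = xc v j.
  move=> j0; elim: l => [|l IH]; first by rewrite addn0.
  by rewrite mulSn addnA -IH addnAC vr // addn_gt0 j0.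
have xcE j : (j < n)%N -> nth false v j = xc v j.+1.
  by move=> jn; rewrite /xc modn_small.
have rlen : (r <= n)%N by apply: dvdn_leq.
have sr : size (take r v) = r by rewrite size_takel.
have vE : v = flatten (nseq (n %/ r) (take r v)).
  have sz : n = size (flatten (nseq (n %/ r) (take r v))).
    by rewrite size_flatten_nseq sr divnK.
  apply: (@eq_from_nth _ false) => // j jn.
  rewrite nth_flatten_nseq -?sz // sr nth_take ?ltn_mod //.
  rewrite (xcE j jn) xcE; last by apply: leq_trans rlen; rewrite ltn_mod.
  by rewrite [in LHS](divn_eq j r) addnC -addSn vrl.
have nrd : (n %/ r <= root_exponent v)%N.
  have lt : (n %/ r < n.+1)%N by rewrite ltnS leq_div.
  have P : `[< exists u, v = flatten (nseq (Ordinal lt) u) >].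
    by apply/asboolP; exists (take r v).
  exact: (@leq_bigmax_cond _
    (fun e : 'I_n.+1 => `[< exists u, v = flatten (nseq e u) >]) (fun e => e : nat)
    (Ordinal lt) P).
have qr : (q <= r)%N.
  have d0 : (0 < root_exponent v)%N by move: v_gt0; rewrite -dq muln_gt0 => /andP[].
  by rewrite -(leq_pmul2l d0) dq -{1}(divnK rn) leq_mul2r nrd orbT.
have -> : q = r by apply/eqP; rewrite eqn_leq qr dvdn_leq // dvdn_gcdr.
exact: dvdn_gcdl.
Qed.

(** Indices of a's count modulo n: they can be taken large, which prevents them
    from reaching 0 along the paths considered. *)
Lemma genA_surj i N : exists2 j, (N <= j)%N & genA w v j.+1 = inr i.
Proof.
exists (i + N * n)%N; first by apply: leq_trans (leq_addl _ _); rewrite leq_pmulr.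
rewrite -(genAE i); apply: genA_modn => /=.
by rewrite addnC modnMDl.
Qed.

(** Agreement on a window of n consecutive letters makes j - i a period. *)
Lemma xc_eq_dvdn i j : (n <= i)%N -> (i <= j)%N ->
  (forall p, (p < n)%N -> xc v (i - p) = xc v (j - p)) -> (q %| j - i)%N.
Proof.
move=> ni ij E; apply: period_dvdn => l l0.
have xcl a b : (0 < a)%N -> (0 < b)%N -> a = b %[mod n] -> xc v a = xc v b.
  move=> a0 b0 ab; rewrite /xc; congr nth; apply/eqP.
  by rewrite -(eqn_modDr 1) !addn1 !prednK // ab.
(* the position of the window at which i - p is congruent to l modulo n *)
pose p := ((i + (n - l %% n)) %% n)%N.
have pn : (p < n)%N by rewrite ltn_mod.
have pE : (p + l = i %[mod n])%N.
  rewrite modnDml -addnA -(modnDmr i) -(modnDmr (n - _)) subnK ?modnn ?addn0 //.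
  by rewrite ltnW // ltn_mod.
have E' := E p pn.
have ip0 : (0 < i - p)%N by rewrite subn_gt0 (leq_trans pn).
have jp0 : (0 < j - p)%N by rewrite subn_gt0 (leq_trans pn) // (leq_trans ni).
have ipl : i - p = l %[mod n].
  apply/eqP; rewrite -(eqn_modDl p) subnKC ?pE //.
  by rewrite ltnW // (leq_trans pn).
rewrite -(xcl _ l ip0 l0 ipl) E'; apply/esym/xcl; rewrite ?addn_gt0 ?l0 //.
have -> : (j - p = (i - p) + (j - i))%N.
  by rewrite addnBAC ?subnKC // ltnW // (leq_trans pn).
by rewrite -modnDml ipl modnDml.
Qed.

(** * Contraction *)

Section Contraction.
Variables (G : groupType) (pi : FM -> G).
Hypothesis piM : {morph pi : x y / x * y}.
Hypothesis pi_Psi : forall g g0 g1, Psi g = (g0, g1, false) ->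
  pi g0 = 1 -> pi g1 = 1 -> pi g = 1.

Let nM := natFM v_gt0 last_neq.

(** The counterexamples of length N; N will be minimal. *)
Let bad N (W : seq (gen w v)) :=
  [/\ size W = N, natF (wordF W) = 1 & pi (wordF W) <> 1].

Let natF_secw W : natF (wordF W) = 1 -> forall c, natF (wordF (secw c W)) = 1.
Proof.
have [e E] := Psi_wordF W.
by move=> /(natF_eq1 E)[_ h0 h1] [].
Qed.

Let bad_section N W :
  (forall W', (size W' < N)%N -> natF (wordF W') = 1 -> pi (wordF W') = 1) ->
  bad N W -> exists c, bad N (secw c W).
Proof.
move=> IH [sW nW pW]; apply: contrapT => /forallNP H; apply: pW.
have [e E] := Psi_wordF W; have [e0 n0 n1] := (natF_eq1 E).1 nW.
rewrite e0 in E.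
have sec1 c : pi (wordF (secw c W)) = 1.
  have := size_secw c W; rewrite leq_eqVlt => /predU1P[sc|]; last first.
    by rewrite sW => /IH; apply; apply: natF_secw.
  by apply: contrapT => pc; apply: (H c); split=> //; [rewrite sc|apply: natF_secw].
exact: pi_Psi E (sec1 false) (sec1 true).
Qed.

(** Some section of a minimal counterexample is again one, of the same length,
    so that no letter dies; and this can be repeated. *)
Let bad_survives N M W :
  (forall W', (size W' < N)%N -> natF (wordF W') = 1 -> pi (wordF W') = 1) ->
  bad N W -> exists2 u, size u = M & forall g, g \in W -> survives u g.
Proof.
move=> IH; elim: M W => [|M IHM] W bW; first by exists [::].
have [c bc] := bad_section IH bW; have [u su Hu] := IHM _ bc.
have [cE Hc] : secw c W = pmap (sec c) W /\ (forall g, g \in W -> sec c g).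
  by apply: secw_pmap; case: bc bW => -> _ _ [->].
exists (c :: u) => [|g gW /=]; first by rewrite /= su.
have := Hc g gW; case E: (sec c g) => [h|] //= _.
by apply: Hu; rewrite cE mem_pmap -E map_f.
Qed.

(** Words in the a's whose indices are congruent to i + 1 modulo n / d: their
    letters commute in F and read v backwards together. *)
Let classA i (ls : seq nat) := [seq genA w v (i.+1 + l * q)%N | l <- ls].

Let secw_noflip c W : (forall g, g \in W -> flip g = false) ->
  secw c W = pmap (sec c) W.
Proof.
elim: W => [//|g W IH] Wf /=; rewrite Wf ?mem_head // addbF IH => [|h hW].
  by case: (sec c g).
by apply: Wf; rewrite inE hW orbT.
Qed.

Let flip_inr i : flip (inr i) = false.
Proof. by rewrite /flip /=; do 2!case: ifP. Qed.

Lemma natF_b_neq1 j : (j < k)%N -> natF (b_ j.+1) <> 1.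
Proof.
elim: j => [|j IH] jk; first by move/(natF_eq1 Psi_b1) => [].
have lj := ltn_predS w_gt0 (ltnW jk).
have nj : ~~ last_gen (genB w v j.+1) by rewrite /= (inordK lj) (ltn_eqF jk).
have -> : genB w v j.+2 = next_gen (genB w v j.+1) by rewrite /= (inordK lj).
have := Psi_next nj; case: ifP => _ /natF_eq1 -> [_ h0 h1]; exact: IH (ltnW jk) _.
Qed.

(** Reading v backwards brings the letter that occurs once to a_1 and the others
    to a_j with j different from 1. The section at the vertex ~~ x_n is then
    b_k for this letter and trivial for the others. *)
Let classA_natF i ls : count (fun l => n %| l * q)%N ls = 1%N ->
  natF (wordF (classA i ls)) <> 1.
Proof.
move=> one; elim: i => [|i IH] /natF_secw natW.
  have := natW (~~ xc v n); rewrite secw_noflip => [|g /mapP[l _ ->]]; last exact: flip_inr.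
  have -> : pmap (sec (~~ xc v n)) (classA 0 ls) = [:: genB w v k].
    rewrite -[[:: _]]/(nseq 1 _) -one; elim: ls {one natW} => [//|l ls IHl] /=.
    have -> : genA w v (1 + l * q) = genA w v (n + l * q).+1.
      by apply: genA_modn; rewrite /= modnDl.
    rewrite sec_a ?addn_gt0 ?v_gt0 // xc_period // modnDl.
    have -> : (~~ xc v n == xc v n) = false by case: (xc v n).
    by rewrite /dvdn; case: (_ == 0%N); rewrite /= IHl.
  rewrite /wordF big_seq1 -[in genB _ _ k](prednK w_gt0).
  by apply: natF_b_neq1; rewrite ltn_predL.
apply: IH; have := natW (xc v i.+1).
rewrite secw_noflip => [|g /mapP[l _ ->]]; last exact: flip_inr.
congr (natF (wordF _) = 1); elim: ls {one natW} => [//|l ls IHl] /=.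
by rewrite addSn sec_a // xc_period // eqxx /= IHl.
Qed.

Let classA_comm i ls : commute (a_ i.+1) (wordF (classA i ls)).
Proof.
elim: ls => [|l' ls IH]; first by rewrite /wordF big_nil; apply: commute1.
by rewrite /= wordF_cons; apply: commuteM => //; apply: F_genC.
Qed.

(** A path of length n + k kills the b_j, and its first n letters determine the
    index of a surviving a up to a period of v. *)
Let survivors_classA u W i : size u = (n + k)%N -> (n <= i)%N ->
  (forall g, g \in genA w v i.+1 :: W -> survives u g) ->
  exists ls, W = classA i ls.
Proof.
move=> su ni; elim: W => [|h W IH] Su; first by exists [::].
have [|ls ->] := IH.
  move=> g; rewrite inE => /orP[/eqP->|gW]; first by apply: Su; rewrite mem_head.
  by apply: Su; rewrite !inE gW !orbT.
have := Su h; rewrite !inE eqxx orbT => /(_ isT).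
case: h {IH} Su => [j|j] Su Sh.
  by have := survives_b Sh; rewrite su leqNgt (leq_trans (ordB_lt j)) // leq_addl.
have [j' ij' jE] := genA_surj j i; rewrite -jE in Sh *.
have /dvdnP[l lE] : (q %| j' - i)%N.
  apply: xc_eq_dvdn => // p pn; have pi' := leq_trans pn ni.
  have pk : (p + k < size u)%N by rewrite su ltn_add2r.
  rewrite -(survives_a (Su _ (mem_head _ _)) pi' pk).
  by rewrite (survives_a Sh (leq_trans pi' ij') pk).
exists (l :: ls); congr (genA _ _ _ :: _).
by rewrite -lE addSn subnKC.
Qed.

(** In a minimal counterexample all the letters belong to one class. If the
    first letter occurs again the two occurrences cancel, which contradicts
    minimality; otherwise the word acts non-trivially on the tree. *)
Lemma contraction x : natF x = 1 -> pi x = 1.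
Proof.
have [W ->] := wordF_surj x; move: {2}(size W).+1 (ltnSn (size W)) => N.
elim: N W => [//|N IHN] W; rewrite ltnS leq_eqVlt => /predU1P[sW|]; last exact: IHN.
move=> nW; apply: contrapT => pW; have bW : bad N W by [].
have [u su] := bad_survives (n + k)%N IHN bW.
case: W sW nW pW {bW} => [|g W] sW nW pW Su.
  by apply: pW; rewrite /wordF big_nil (morph_one piM).
case: g => [j|j] in sW nW pW Su *.
  have := survives_b (Su _ (mem_head _ _)).
  by rewrite su leqNgt (leq_trans (ordB_lt j)) // leq_addl.
have [i ni jE] := genA_surj j n; rewrite -jE in sW nW pW Su.
have [ls WE] := survivors_classA su ni Su; subst W.
have [/hasP[l lls dl]|] := boolP (has (fun l => n %| l * q)%N ls); last first.
  rewrite has_count -eqn0Ngt => /eqP c0.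
  have := @classA_natF i (0%N :: ls); rewrite /= mul0n dvdn0 c0 !addn0.
  by move=> /(_ erefl); apply.
case/splitPr: lls sW nW pW {Su} => l1 l2.
have lE : genA w v (i.+1 + l * q) = genA w v i.+1.
  by apply: genA_modn; rewrite addSn /= -modnDmr (eqP dl) addn0.
have wE : wordF (genA w v i.+1 :: classA i (l1 ++ l :: l2)) = wordF (classA i (l1 ++ l2)).
  rewrite /classA !map_cat /= lE wordF_cons !wordF_cat wordF_cons mulgA.
  by rewrite (classA_comm i l1) -mulgA (mulgA (a_ i.+1)) F_gen2 mul1g.
rewrite wE => sW nW; apply; apply: IHN nW.
by rewrite -sW /= !size_map !size_cat /= addnS ltnW.
Qed.

End Contraction.

(** * The presentation *)

Section Quotient.
Variables (s t : FM) (m : nat).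
Local Notation wordHt := (wordH t).
Local Notation prj := (@Fbar_proj w v s t m).
Local Notation relR g h c := [~ F_gen (next_gen g), F_gen (next_gen h) ^ wordHt c].

Let prjM : {morph prj : x y / x * y}.
Proof. exact: quot_projM. Qed.

Lemma proj_wordH c :
  prj (wordHt c) = \prod_(i <- c) (if i then Fbar_gen s t m (genB w v 1) else prj (a_ 1 ^ t)).
Proof.
elim: c => [|i c IH]; first by rewrite /wordH !big_nil (morph_one prjM).
by rewrite wordH_cons prjM IH big_cons; case: i.
Qed.

Let genB_next i : (2 <= i <= k)%N -> exists j, [/\ ~~ last_gen (inl j),
  genB w v i = next_gen (inl j) & y_ i.-1 = gen_letter (inl j)].
Proof.
case: i => [|[|i]] // /andP[_ ik]; have lj := ltn_predS w_gt0 (ltnW ik).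
by exists (inord i); rewrite /= (inordK lj) (ltn_eqF ik).
Qed.

Let genA_next i : (2 <= i <= n)%N -> exists j, [/\ ~~ last_gen (inr j),
  genA w v i = next_gen (inr j) & x_ i.-1 = gen_letter (inr j)].
Proof.
case: i => [|[|i]] // /andP[_ ik]; have lj := ltn_predS v_gt0 (ltnW ik).
by exists (inord i); rewrite /= (inordK lj) (ltn_eqF ik).
Qed.

Lemma calR_lift r : calR s t m r -> exists g h c, [/\ ~~ last_gen g, ~~ last_gen h,
  odd (count id c) = (gen_letter g == gen_letter h) & r = prj (relR g h c)].
Proof.
have E g h c x :
    x = \prod_(i <- c) (if i then Fbar_gen s t m (genB w v 1) else prj (a_ 1 ^ t)) ->
    [~ Fbar_gen s t m (next_gen g), Fbar_gen s t m (next_gen h) ^ x] = prj (relR g h c).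
  move=> ->; rewrite (morph_comm prjM) [prj (_ ^ wordHt c)](morph_conj prjM).
  by rewrite proj_wordH.
case=> [[]|].
- case=> i [j [x [/genB_next[g [ng -> ->]] /genB_next[h [nh -> ->]] [c oc xE] ->]]].
  by exists (inl g), (inl h), c; split=> //; apply: E.
- case=> i [j [x [/genA_next[g [ng -> ->]] /genB_next[h [nh -> ->]] [c oc xE] ->]]].
  by exists (inr g), (inl h), c; split=> //; apply: E.
- case=> i [j [x [/genA_next[g [ng -> ->]] /genA_next[h [nh -> ->]] [c oc xE] ->]]].
  by exists (inr g), (inr h), c; split=> //; apply: E.
Qed.

(** R contains the commutators of an a with a conjugate of a b, but not those of
    a b with a conjugate of an a; up to inversion and conjugacy these are the
    former with g replaced by its inverse. *)
Lemma relR_calR g h c : ~~ last_gen g -> ~~ last_gen h ->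
  odd (count id c) = (gen_letter g == gen_letter h) ->
  calR s t m (prj (relR g h c)) \/ calR s t m (prj (relR h g (rev c))).
Proof.
move=> ng nh oc; rewrite !(morph_comm prjM) !(morph_conj prjM).
have W c' p : odd (count id c') = p -> words_parity p (prj (wordHt c')).
  by move=> <-; exists c' => //; apply: proj_wordH.
case: g ng oc => [i|i] ni; case: h nh => [j|j] nj oc.
- left; left; left; exists i.+2, j.+2, (prj (wordHt c)); rewrite !nonlast_ltB //.
  by split=> //; apply: W.
- right; left; right; exists j.+2, i.+2, (prj (wordHt (rev c))).
  rewrite nonlast_ltB // nonlast_ltA //; split=> //; apply: W.
  by rewrite count_rev oc eq_sym.
- left; left; right; exists i.+2, j.+2, (prj (wordHt c)).
  by rewrite nonlast_ltB // nonlast_ltA //; split=> //; apply: W.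
- left; right; exists i.+2, j.+2, (prj (wordHt c)); rewrite !nonlast_ltA //.
  by split=> //; apply: W.
Qed.

Hypothesis st : good_choice s t m.

Local Notation S := (\bigcup_l (iter l (phibar s t m) @` calR s t m)).
Let pi x := quot_proj S (prj x).

Let piM : {morph pi : x y / x * y}.
Proof. by move=> x y; rewrite /pi prjM quot_projM. Qed.

Let iter_phibar l x : iter l (phibar s t m) (prj x) = prj (iter l (phi t) x).
Proof. by elim: l => [//|l IH]; rewrite !iterS IH phibar_proj. Qed.

Let S_lift y : S y -> exists l g h c, [/\ ~~ last_gen g, ~~ last_gen h,
  odd (count id c) = (gen_letter g == gen_letter h) & y = prj (iter l (phi t) (relR g h c))].
Proof.
case=> l _ [r /calR_lift[g [h [c [ng nh oc ->]]]] <-].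
by exists l, g, h, c; rewrite iter_phibar.
Qed.

Let facts := good_choice_facts st.

Let pi_rel : pi ((a_ n ^ s * b_ k) ^+ (2 ^ m)%N) = 1.
Proof.
have -> : pi ((a_ n ^ s * b_ k) ^+ (2 ^ m)%N) = pi 1; last exact: morph_one piM.
rewrite /pi; congr (quot_proj S _).
rewrite (morph_one prjM); apply/quot_proj_eq1; apply: sub_gen_smallest.
by exists 0%N.
Qed.

Let pi_phi x : pi x = 1 -> pi (phi t x) = 1.
Proof.
move=> /quot_proj_eq1 Nx; rewrite /pi -phibar_proj //.
pose f := quot_proj S \o phibar s t m.
have fM : {morph f : x y / x * y}.
  by move=> y z; rewrite /f /= phibarM // quot_projM.
apply: (normal_closure_kernel fM) Nx => y [l _ [r Rr <-]].
by apply/quot_proj_eq1; apply: sub_gen_smallest; exists l.+1 => //; exists r.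
Qed.

(** theta induces a map on Fbar since it kills its relators, and this map kills
    phi^l(R). *)
Let pi_theta x : pi x = 1 -> pi (theta s x) = 1.
Proof.
have [sB tB Pu _ mc] := facts.
have tM : {morph pi \o theta s : x y / x * y}.
  by move=> y z /=; rewrite thetaM // piM.
have tS y : Fbar_rels s t m y -> (pi \o theta s) y = 1.
  by case=> l _ <-; exact: (collapse_rel t mc piM pi_rel).
move=> /quot_proj_eq1 Nx; rewrite -[LHS]/((pi \o theta s) x) -(quot_lift_proj tM tS).
apply: (normal_closure_kernel (quot_liftM tM tS)) Nx => _ /S_lift[l [g [h [c [ng nh oc ->]]]]].
rewrite (quot_lift_proj tM tS).
exact: (collapse_R t sB mc piM pi_rel l c ng nh).
Qed.

Let pi_R g h c : ~~ last_gen g -> ~~ last_gen h ->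
  odd (count id c) = (gen_letter g == gen_letter h) ->
  commute (pi (F_gen (next_gen g))) (pi (F_gen (next_gen h) ^ wordHt c)).
Proof.
move=> ng nh oc; have Sr r : calR s t m r -> quot_proj S r = 1.
  by move=> Rr; apply/quot_proj_eq1; apply: sub_gen_smallest; exists 0%N => //; exists r.
have [/Sr|/Sr] := relR_calR ng nh oc; rewrite -/(pi _) (morph_comm piM) => /eqP/commgP //.
move=> /commute_sym /(commuteJ _ _ (pi (wordHt c))).
by rewrite wordH_rev !(morph_conj piM) (morphV piM) conjgKV.
Qed.

Lemma presentation : exists p : {multiplicative Fbar s t m -> tree_aut},
    [/\ forall g : gen w v, p (Fbar_gen s t m g) = gen_aut g,
        range p = K w v &
        [set x | p x = 1] = normal_closure S].
Proof.
have [sB tB Pu nr mc] := facts.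
have nM := natFM v_gt0 last_neq.
have nS y : Fbar_rels s t m y -> natF y = 1.
  by case=> l _ <-; exact: (natF_rel Pu mc nr).
pose p : Fbar s t m -> tree_aut := quot_lift (@natF w v).
have pE x : p (prj x) = natF x by exact: quot_lift_proj nM nS x.
have pM : {morph p : x y / x * y} by exact: quot_liftM nM nS.
pose pm : {multiplicative Fbar s t m -> tree_aut} :=
  HB.pack p (monoid.isMultiplicative.Build _ _ p pM).
have prj_surj y : exists x, y = prj x by exists (quot_repr y); rewrite [RHS]quot_reprK.
exists pm; split=> [g|/=|/=].
- by rewrite [LHS]pE natF_gen.
- apply/seteqP; split=> [_ [y _ <-]|].
    have [x ->] := prj_surj y; rewrite [X in K w v X]pE; have [W ->] := wordF_surj x.
    have sK : is_subgroup (K w v) by exact: gen_subgroup_subgroup.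
    elim: W => [|g W IH]; first by rewrite /wordF big_nil (morph_one nM); exact: sK.1.
    rewrite wordF_cons nM natF_gen //; apply: (subgroupM sK) IH.
    by apply: mem_gen_subgroup; exists g.
  apply: gen_subgroup_sub; last first.
    by move=> _ [g _ <-]; exists (Fbar_gen s t m g) => //; rewrite [LHS]pE natF_gen.
  split; first by exists 1 => //; exact: morph_one pM.
  by move=> _ _ [x _ <-] [y _ <-]; exists (x / y) => //; rewrite [LHS]pM (morphV pM).
apply/seteqP; split=> [y|y Ny]; last first.
  apply: (normal_closure_kernel pM) Ny => _ /S_lift[l [g [h [c [ng nh oc ->]]]]].
  by rewrite pE; exact: (natF_R sB Pu mc nr).
have [x ->] := prj_surj y; rewrite /mkset [X in X = 1]pE => nx.
apply/quot_proj_eq1; rewrite -/(pi x); apply: (contraction piM) nx.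
exact: (pi_Psi_eq1 sB tB Pu piM pi_phi pi_theta pi_R).
Qed.
End Quotient.
End Kneading.

Theorem theorem4p8 (w v : seq bool)
  (w_gt0 : (0 < size w)%N) (v_gt0 : (0 < size v)%N)
  (last_neq : letter w (size w) != letter v (size v))
  (not11 : (size w, size v) != (1, 1)%N)
  (s t : F w v) (m : nat) (st_choice : good_choice s t m) :
  exists p : {multiplicative Fbar s t m -> tree_aut},
    [/\ forall g : gen w v, p (Fbar_gen s t m g) = gen_aut g,
        range p = K w v &
        [set x | p x = 1] =
        normal_closure (\bigcup_l (iter l (phibar s t m) @` calR s t m))].
Proof. exact: presentation. Qed.
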